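(* (1) Let $u\ge 0$. Then, under $P^u$, the random variables $\{R_n/2^n-1\}_{n\ge 1}$ converge weakly as $n\to\infty$ to a probability distribution on $[0,1]$, whose distribution function is denoted by $f_u$. (2) Let $u>0$. Then $f=f_u$ satisfies the functional equation $$f(x)=\begin{cases}\Phi(A_{u,0};f(2x)) & 0\le x\le 1/2,\\ \Phi(A_{u,1};f(2x-1)) & 1/2\le x\le 1.\end{cases}$$ (3) Let $\widetilde P^u$ be the probability measure on $[0,1]$ whose distribution function is $f_u$. If $u=1$, then $\widetilde P^u$ is absolutely continuous with respect to the Lebesgue measure on $[0,1]$. If $u\ne 1$ (with $u\ge 0$), then $\widetilde P^u$ is singular with respect to the Lebesgue measure on $[0,1]$.
   Context: Constants and matrices. For $u\ge 0$ let $x_u=\frac{2}{1+\sqrt{1+8u^2}}$, and $$A_{u,0}=\begin{pmatrix} x_u & 0\\ -u^2x_u^2 & 1\end{pmatrix},\qquad A_{u,1}=\begin{pmatrix} 0 & x_u\\ -u^2x_u^2 & 1-u^2x_u^2\end{pmatrix}.$$ For a matrix $A=\begin{pmatrix} a&b\\c&d\end{pmatrix}$ put $\Phi(A;z)=\frac{az+b}{cz+d}$. Paths. For $n\ge 0$ let $W(n)$ be the set of $(\omega(0),\dots,\omega(n))\in\mathbb Z^{n+1}$ with $\omega(0)=0$ and $|\omega(i)-\omega(i+1)|=1$ for $0\le i\le n-1$; let $W^*=\bigcup_{n\ge 0}W(n)$ and $L(\omega)=n$ for $\omega\in W(n)$. For $\omega\in W^*$ and integers $M\ge 0$, let $T_0^M(\omega)=0$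 and, for $i\ge 1$, $T_i^M(\omega)=\min\{j>T_{i-1}^M(\omega):\omega(j)\in 2^M\mathbb Z\setminus\{\omega(T_{i-1}^M(\omega))\}\}$, with value $+\infty$ if the minimum does not exist. Let $(2^{-M}Q_M\omega)(i)=2^{-M}\omega(T_i^M(\omega))$ for all $i$ with $T_i^M(\omega)<\infty$; this is an element of $W^*$. Let $W_{N,\pm}=\{\omega\in W^*: L(\omega)=T_1^N(\omega),\ \omega(T_1^N(\omega))=\pm 2^N\}$. Measures. For $\omega\in W_{1,+}$ let $P^u_{1,+}(\{\omega\})=u^{L(\omega)-2}x_u^{L(\omega)-1}$ (with $0^0=1$, and $0^n=0$ for $n\geq 1$). Inductively, for $N\ge1$ and $\omega\in W_{N+1,+}$, let $\omega'=2^{-N}Q_N\omega\in W_{1,+}$ and, for $1\le j\le L(\omega')$, let $\widetilde\omega_j\in W_{N,+}$ be the path obtained from the segment $(\omega(T^N_{j-1}(\omega)+i)-\omega(T^N_{j-1}(\omega)))_{0\le i\le T^N_j(\omega)-T^N_{j-1}(\omega)}$ by multiplying it by the sign of $\omega(T_j^N(\omega))-\omega(T_{j-1}^N(\omega))$; set $P^u_{N+1,+}(\{\omega\})=P^u_{1,+}(\{\omega'\})\prod_{j=1}^{L(\omega')}P^u_{N,+}(\{\widetilde\omega_j\})$. Each $P^u_{N,+}$ is a probability measure on $W_{N,+}$. Let $P^u_{N,-}(\{\omega\})=P^u_{N,+}(\{-\omega\})$ for $\omega\in W_{N,-}$. Let $W_\infty$ be the set of infinite paths $(\omega(0),\omega(1),\dots)$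 in $\mathbb Z$ with $\omega(0)=0$ and $|\omega(i)-\omega(i+1)|=1$ for all $i\ge0$, with the $\sigma$-algebra generated by cylinder sets. $P^u$ is the probability measure on $W_\infty$ (known to exist) such that for all $N\ge1$ and $\widetilde\omega\in W_{N,+}$ (resp. $W_{N,-}$), $P^u(\{\omega\in W_\infty:\omega(j)=\widetilde\omega(j),\ 0\le j\le L(\widetilde\omega)\})=\frac12P^u_{N,+}(\{\widetilde\omega\})$ (resp. $\frac12P^u_{N,-}(\{\widetilde\omega\})$). Range. For $n\ge1$ and $\omega\in W_\infty$, $R_n(\omega)$ is the number of points of $\mathbb Z$ that $\omega$ visits before it hits the set $\{2^n,-2^n\}$. *)

(* Defs.v *)
From HB Require Import structures.
From mathcomp Require Import all_boot all_order all_algebra.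
From mathcomp Require Import finmap zify.
From mathcomp Require Import all_classical all_reals all_analysis.
From mathcomp Require Import measurable_realfun.

Set Implicit Arguments.
Unset Strict Implicit.
Unset Printing Implicit Defensive.

Import Order.TTheory GRing.Theory Num.Theory.
Import numFieldNormedType.Exports.

Local Open Scope classical_set_scope.
Local Open Scope ring_scope.

Section Constants.
Context {R : realType}.
Implicit Types (a b c d u z : R) (A : 'M[R]_2).

Definition x_ u : R := 2 / (1 + Num.sqrt (1 + 8 * u ^+ 2)).

Definition mx22 a b c d : 'M[R]_2 :=
  \matrix_(i, j) if i == 0 then (if j == 0 then a else b)
                 else (if j == 0 then c else d).

Definition A0 u : 'M[R]_2 :=
  mx22 (x_ u) 0 (- (u ^+ 2 * x_ u ^+ 2)) 1.

Definition A1 u : 'M[R]_2 :=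
  mx22 0 (x_ u) (- (u ^+ 2 * x_ u ^+ 2)) (1 - u ^+ 2 * x_ u ^+ 2).

Definition Phi A z : R := (A 0 0 * z + A 0 1) / (A 1 0 * z + A 1 1).

End Constants.

(* A finite path (w(0), ..., w(n)) is the sequence of its n + 1 positions. *)
Definition Wstar : pred (seq int) := fun w =>
  if w is a :: s then (a == 0) && path (fun p q : int => `|p - q| == 1) a s
  else false.

Definition L (w : seq int) : nat := (size w).-1.

(* [ohead] picks the least index since [iota] is increasing, and [None] stands
   for +oo. *)
Definition next_hit (M : nat) (w : seq int) (i : nat) : option nat :=
  ohead [seq j <- iota i.+1 (L w - i) | (2 ^+ M %| w`_j)%Z && (w`_j != w`_i)].

Fixpoint T (M : nat) (w : seq int) (i : nat) : option nat :=
  if i is i'.+1 then obind (next_hit M w) (T M w i') else Some 0%N.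

(* The finite values of T_i form an initial segment and T_i >= i, so that
   i <= L w whenever T_i is finite. *)
Definition Q (M : nat) (w : seq int) : seq int :=
  [seq (w`_t %/ 2 ^+ M)%Z | t <- pmap (T M w) (iota 0 (size w))].

Definition Wplus (N : nat) : pred (seq int) := fun w =>
  [&& Wstar w, T N w 1 == Some (L w) & w`_(L w) == 2 ^+ N].

Definition Wminus (N : nat) : pred (seq int) := fun w =>
  [&& Wstar w, T N w 1 == Some (L w) & w`_(L w) == - 2 ^+ N].

Definition segment (N : nat) (w : seq int) (j : nat) : seq int :=
  let s := odflt 0%N (T N w j.-1) in
  let t := odflt 0%N (T N w j) in
  mkseq (fun i => sgz (w`_t - w`_s) * (w`_(s + i) - w`_s)) (t - s).+1.

Section PathMeasures.
Context {R : realType}.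
Variable u : R.

(* [Pplus N] and [Pminus N] are mass functions on [Wplus N] and [Wminus N] for
   N >= 1; their values on other arguments are irrelevant. *)
Definition P1plus (w : seq int) : R := u ^+ (L w - 2) * x_ u ^+ (L w - 1).

Fixpoint Pplus (N : nat) (w : seq int) : R :=
  match N with
  | 0 => 0
  | N'.+1 =>
      if N' == 0%N then P1plus w
      else P1plus (Q N' w) *
           \prod_(1 <= j < (L (Q N' w)).+1) Pplus N' (segment N' w j)
  end.

Definition Pminus (N : nat) (w : seq int) : R := Pplus N (map -%R w).

End PathMeasures.

Record Winfty := MkWinfty {
  pos :> nat -> int;
  pos0 : pos 0 = 0;
  pos_step : forall i, `|pos i - pos i.+1| = 1 }.

HB.instance Definition _ := gen_eqMixin Winfty.
HB.instance Definition _ := gen_choiceMixin Winfty.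

Definition zigzag (i : nat) : int := (odd i)%:Z.

Lemma zigzag_step i : `|zigzag i - zigzag i.+1| = 1.
Proof. by rewrite /zigzag /=; case: (odd i). Qed.

HB.instance Definition _ :=
  isPointed.Build Winfty (MkWinfty (erefl : zigzag 0 = 0) zigzag_step).

Definition cylinder (w : seq int) : set Winfty :=
  [set om | forall j, (j <= L w)%N -> om j = w`_j].

Definition cylinders : set (set Winfty) := [set cylinder w | w in Wstar].

HB.instance Definition _ :=
  Measurable.copy Winfty (g_sigma_algebraType cylinders).

Definition is_Pu {R : realType} (u : R) (P : probability Winfty R) : Prop :=
  forall N : nat, (1 <= N)%N ->
    (forall w, Wplus N w -> P (cylinder w) = (2^-1 * Pplus u N w)%:E) /\
    (forall w, Wminus N w -> P (cylinder w) = (2^-1 * Pminus u N w)%:E).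

Definition visited (n : nat) (om : Winfty) : set int :=
  [set x | exists j, om j = x /\
     forall i, (i <= j)%N -> om i != 2 ^+ n /\ om i != - 2 ^+ n].

Definition Rn (n : nat) (om : Winfty) : nat :=
  #|` fset_set (visited n om)|%fset.

Lemma measurable_pos (j : nat) (x : int) :
  measurable [set om : Winfty | om j = x].
Proof.
pose good w := [&& Wstar w, L w == j & w`_j == x].
have -> : [set om : Winfty | om j = x] =
    \bigcup_(k in [set k : nat | oapp good false (choice.unpickle k)])
      cylinder (odflt [::] (choice.unpickle k)).
  rewrite predeqE => om; split => [omj|[k]]; last first.
    rewrite /mkset; case: (choice.unpickle k) => //=.
    move=> w /and3P[_ /eqP Lw /eqP wj] om_w.
    have := om_w j; rewrite /mkset.
    by rewrite Lw leqnn wj => ->.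
  exists (choice.pickle (mkseq om j.+1)); rewrite /mkset choice.pickleK; last first.
    by move=> i /=; rewrite /L size_mkseq /= => ij; rewrite nth_mkseq.
  rewrite /good /= /L size_mkseq /= eqxx nth_mkseq // omj eqxx !andbT.
  rewrite /Wstar /mkseq /= pos0 eqxx /= -[X in path _ X](pos0 om).
  elim: (j) 0%N => //= k IH m.
  by rewrite pos_step eqxx IH.
apply: bigcup_measurable => k.
rewrite /mkset; case: (choice.unpickle k) => //= w /and3P[Ww _ _].
by apply: sub_sigma_algebra; exists w.
Qed.

Lemma visited_bound (n : nat) (om : Winfty) (x : int) :
  visited n om x -> `|x| < 2 ^+ n.
Proof.
case=> j [<-]; elim: j => [|j IH] nhit.
  by rewrite pos0 normr0 exprn_gt0.
have {IH} : `|om j| < 2 ^+ n by apply: IH => i ij; apply: nhit; exact: leqW.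
have := pos_step om j; have [] := nhit j.+1 (leqnn _).
lia.
Qed.

Definition box (n : nat) : seq int :=
  [seq k%:Z - 2 ^+ n | k <- iota 0 (2 ^ n.+1)].

Lemma visited_box n om x : visited n om x -> x \in box n.
Proof.
move=> /visited_bound xn; apply/mapP.
exists (absz (x + 2 ^+ n)); last by lia.
rewrite mem_iota add0n expnS.
have : (2 ^ n)%N%:Z = 2 ^+ n :> int by rewrite -natrX natz.
lia.
Qed.

Lemma finite_visited n om : finite_set (visited n om).
Proof.
apply: (sub_finite_set (@visited_box n om)); exact: finite_seq.
Qed.

Lemma measurable_visited n x : measurable [set om | visited n om x].
Proof.
have -> : [set om | visited n om x] =
    \bigcup_j ([set om : Winfty | om j = x] `&`
      \bigcap_(i in [set i | (i <= j)%N])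
         (~` [set om | om i = 2 ^+ n] `&` ~` [set om | om i = - 2 ^+ n])).
  apply/seteqP; split=> om /=.
    case=> j [jx h]; exists j => //; split=> // i /= /h [/eqP ? /eqP ?].
    by split.
  case=> j _ [/= jx h]; exists j; split=> // i ij.
  by have [/= /eqP ? /eqP ?] := h i ij.
apply: bigcup_measurable => j _; apply: measurableI.
  exact: measurable_pos.
apply: bigcap_measurable => //; first by exists 0%N.
by move=> i _; apply: measurableI; apply: measurableC; exact: measurable_pos.
Qed.

Lemma RnE (R : realType) n (om : Winfty) :
  (Rn n om)%:R = \sum_(x <- box n) \1_[set om | visited n om x] om :> R.
Proof.
have ubox : uniq (box n).
  by rewrite map_inj_uniq ?iota_uniq // => a b; lia.
rewrite /Rn.
have /perm_size : perm_eq (fset_set (visited n om))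
    [seq x <- box n | x \in visited n om].
  apply: uniq_perm; rewrite ?filter_uniq //.
  move=> x; rewrite in_fset_set; last exact: finite_visited.
  rewrite mem_filter; case: (boolP (x \in visited n om)) => //=.
  by move=> /set_mem/visited_box.
move=> ->; rewrite size_filter -sum1_count natr_sum big_mkcond /=.
apply: eq_bigr => x _; rewrite indicE.
have -> : (om \in [set om | visited n om x]) = (x \in visited n om).
  by apply/idP/idP => /set_mem h; apply/mem_set.
by case: (x \in _).
Qed.

Section Scaled.
Context {R : realType}.

Definition scaled_range (n : nat) (om : Winfty) : R :=
  (Rn n om)%:R / 2 ^+ n - 1.

Lemma measurable_scaled_range n : measurable_fun setT (scaled_range n).
Proof.
apply: measurable_funB => //; apply: measurable_funM => //.
under eq_fun do rewrite RnE.
apply: measurable_sum => x; apply: measurable_indic.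
exact: measurable_visited.
Qed.

HB.instance Definition _ n :=
  isMeasurableFun.Build _ _ Winfty R (scaled_range n)
    (@measurable_scaled_range n).

Definition weak_cvg d (Omega : measurableType d) (P : probability Omega R)
    (X : nat -> {RV P >-> R}) (mu : probability (measurableTypeR R) R) : Prop :=
  forall g : R -> R, continuous g -> bounded_fun g ->
    (\int[P]_om (g (X n om))%:E)%E @[n --> \oo] --> (\int[mu]_x (g x)%:E)%E.

Definition distribution_function (mu : probability (measurableTypeR R) R)
    (x : R) : R := fine (mu `]-oo, x]%classic).

Definition lebesgue01 : set (measurableTypeR R) -> \bar R :=
  mrestr lebesgue_measure (measurable_itv `[0%R, 1%R]).

HB.instance Definition _ := Measure.on lebesgue01.

Definition mutually_singular d (S : measurableType d)
    (mu nu : {measure set S -> \bar R}) : Prop :=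
  exists A, [/\ measurable A, mu A = 0%E & nu (~` A) = 0%E].

End Scaled.

(* Main.v *)
Require Import Defs.
From HB Require Import structures.
From mathcomp Require Import all_boot all_order all_algebra.
From mathcomp Require Import finmap zify ring lra.
From mathcomp Require Import all_classical all_reals all_analysis.
From mathcomp Require Import measurable_realfun.

Set Implicit Arguments.
Unset Strict Implicit.
Unset Printing Implicit Defensive.

Import Order.TTheory GRing.Theory Num.Theory.
Import numFieldNormedType.Exports.

Local Open Scope classical_set_scope.
Local Open Scope ring_scope.

(** A path conditioned to leave the interval ]-2^n, 2^n[ through 2^n has visited
    2^n + m points by then, where - m is its minimum, and by the symmetry of P^u the
    side of exit is irrelevant to the range.  So everything is about the law of m.

    A first-exit word of level N+1 is a chain of signed words of level N: a number
    of loops, each going up and back down or down and back up, and then two ups.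
    Its mass is the product of the masses of the pieces by x for the final two ups
    and by a = u^2 x^2 for each loop, with x = 1 - 2 a.  Requiring that the word
    stay above - k restricts the pieces as follows: if k < 2^N the loops through - 2^N are
    forbidden and every up starting at 0 must stay above - k, and if k >= 2^N every
    up starting at - 2^N must stay above - (k - 2^N).  Summing over the number of
    loops, the mass of the restricted words is Phi (A0 u) or Phi (A1 u) applied to
    the mass of the restricted words one level below ([word_mass_above]).  Thus the
    distribution function of R_n / 2^n - 1 is exactly the step function
    [finite_cdf u n], obtained by iterating the functional equation from the point
    mass at 0 ([scaled_range_cdf]).  These words have total mass 1, and their
    cylinders are disjoint, so up to a null set every path starts with one of them or
    with the mirror image of one.

    The functions [finite_cdf u n] decrease with n to a right-continuous
    distribution function [limit_cdf u], which inherits the functional equation.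
    At dyadic points the limit is reached after finitely many steps, which says that
    the law of R_n / 2^n - 1 is the image of the limit law under rounding down to
    the grid of mesh 2^-n ([round_down_cdf]).  Weak convergence follows by dominated
    convergence, including for u > sqrt 3, where the limit law has atoms at all
    dyadic points of ]0, 1].

    For u = 1 the solution is 2 y / (1 + y), which is 2-Lipschitz, so the limit law
    is at most twice the Lebesgue measure.

    For the singular case the tool is the Hellinger affinity between the limit law
    and the Lebesgue measure along the dyadic partitions, the sum of the square
    roots of 2^-n mu(I) over the dyadic intervals I of level n.  The restriction of
    mu to a dyadic interval, rescaled, has distribution function z |-> (1 + t) z /
    (1 + t z) composed with [limit_cdf u] for some t in ]-1, 0], and passing to the
    two halves transforms t by explicit maps ([mobius_Phi0], [mobius_Phi1]).  A
    split with proportions p, 1 - p multiplies the affinity by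
    (sqrt p + sqrt (1 - p)) / sqrt 2, which is less than 1 unless p = 1/2.  When x
    is neither 1 nor 1/2, p cannot be close to 1/2 both for an interval and for its
    left half ([left_mass_gap]), so the affinity decays geometrically
    ([affinity_decay]).  The dyadic intervals with mu(I) >= 2^-n have Lebesgue
    measure at most the affinity and the others have mu-measure at most the
    affinity, and the Borel-Cantelli lemma applied to both families separates the
    two measures ([limit_law_singular]).  The remaining value u = 0, that is x = 1,
    gives the point mass at 0. *)

(** * Concatenation of paths and hitting times *)

(** The path [v] run after [s]; the starting point 0 of [v] is dropped because it is
    the endpoint of [s]. *)
Definition chain (s v : seq int) : seq int :=
  s ++ [seq y + last 0 s | y <- behead v].

(** The first exit from the interval of radius [2 ^+ N] at [e * 2 ^+ N].  Stated with
    norms only, which makes it stable under concatenation; for [e] equal to 1 or -1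
    it implies membership in W_{N,+} or W_{N,-}, since 0 is the only multiple of
    [2 ^+ N] inside the interval. *)
Definition exits (N : nat) (e : int) (s : seq int) : Prop :=
  [/\ Wstar s, (0 < L s)%N, forall i, (i < L s)%N -> `|s`_i| < 2 ^+ N
    & s`_(L s) = e * 2 ^+ N].

Lemma size_Wstar s : Wstar s -> size s = (L s).+1.
Proof. by case: s. Qed.

Lemma Wstar_nth0 s : Wstar s -> s`_0 = 0.
Proof. by case: s => //= a s /andP[/eqP]. Qed.

Lemma last_nthL s : Wstar s -> last 0 s = s`_(L s).
Proof. by move=> Ws; rewrite -nth_last. Qed.

Lemma Wstar_cons v : Wstar v -> v = 0 :: behead v.
Proof. by case: v => //= a s /andP[/eqP->]. Qed.

Lemma Wstar_chain s v : Wstar s -> Wstar v -> Wstar (chain s v).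
Proof.
case: s => //= a s /andP[/eqP -> ps]; case: v => //= b v /andP[/eqP -> pv].
rewrite /= cat_path ps /=; set c := last 0 s.
have := @path_map _ _ (+%R^~ c) (fun p q : int => `|p - q| == 1) 0 v.
rewrite /= add0r => ->; apply: sub_path pv => p q /= /eqP <-.
by apply/eqP; congr `|_|; lia.
Qed.

Lemma L_chain s v : Wstar s -> Wstar v -> L (chain s v) = (L s + L v)%N.
Proof. by case: s => // a s _; case: v => // b v _; rewrite /L /= size_cat size_map. Qed.

Lemma nth_chain_l s v i : Wstar s -> (i <= L s)%N -> (chain s v)`_i = s`_i.
Proof. by move=> Ws iL; rewrite nth_cat size_Wstar // ltnS iL. Qed.

Lemma nth_chain_r s v i : Wstar s -> Wstar v -> (i <= L v)%N ->
  (chain s v)`_(L s + i) = v`_i + s`_(L s).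
Proof.
move=> Ws Wv; case: i => [_|i iv].
  by rewrite addn0 nth_chain_l // Wstar_nth0 // add0r.
rewrite nth_cat size_Wstar // ltnNge; have -> /= : (L s < L s + i.+1)%N by lia.
have -> : (L s + i.+1 - (L s).+1 = i)%N by lia.
rewrite (nth_map 0) ?last_nthL ?nth_behead // size_behead size_Wstar //.
Qed.

Lemma chain_nil s : chain s [:: 0] = s.
Proof. exact: cats0. Qed.

Lemma all_ge_chain (c : int) s v : Wstar s -> Wstar v ->
  all (fun y : int => c <= y) (chain s v) =
    all (fun y : int => c <= y) s && all (fun y : int => c - s`_(L s) <= y) v.
Proof.
move=> Ws Wv; rewrite all_cat; case: allP => //= hs.
have hL : c <= s`_(L s) by apply: hs; rewrite mem_nth // size_Wstar.
rewrite [in RHS](Wstar_cons Wv) /= last_nthL // all_map.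
have -> /= : c - s`_(L s) <= 0 by lia.
by apply: eq_all => y /=; lia.
Qed.

Lemma T_le M w i t : T M w i = Some t -> (i <= t <= L w)%N.
Proof.
elim: i t => [|i IH] t /=; first by case=> <-.
case E: (T M w i) => [r|//]; have rP := IH _ E.
rewrite /= /next_hit => h.
have : t \in [seq j <- iota r.+1 (L w - r) | (2 ^+ M %| w`_j)%Z && (w`_j != w`_r)].
  by move: h; case: [seq _ <- _ | _] => //= a l [->]; rewrite mem_head.
by rewrite mem_filter mem_iota => /andP[_]; lia.
Qed.

Lemma exits_dvd N e s : exits N e s -> (2 ^+ N %| s`_(L s))%Z.
Proof. by case=> _ _ _ ->; apply: dvdz_mull. Qed.

(** Before its last step, [s] meets no multiple of [2 ^+ N] other than 0. *)
Lemma exits_next_hit N e s v : e != 0 -> exits N e s -> Wstar v ->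
  next_hit N (chain s v) 0 = Some (L s).
Proof.
move=> e0 sP Wv; have [Ws L0 si sL] := sP; rewrite /next_hit subn0 L_chain //.
have -> : (L s + L v = (L s).-1 + (1 + L v))%N by lia.
rewrite iotaD filter_cat.
rewrite (_ : [seq _ <- iota 1 _ | _] = [::]) /=; last first.
  apply/eqP; rewrite -[_ == _]negbK -has_filter; apply/hasPn => j.
  rewrite mem_iota => jP; rewrite !nth_chain_l //; try lia.
  rewrite (Wstar_nth0 Ws) negb_and negbK orbC -implyNb; apply/implyP => sj0.
  apply: contraL (si j _) => [/dvdzP[q qE]|]; last by lia.
  rewrite qE normrM (ger0_norm (_ : 0 <= 2 ^+ N)) // -leNgt ler_peMl //.
  have : q != 0 by apply: contraNneq sj0 => q0; rewrite qE q0 mul0r.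
  lia.
have -> : (1 + (L s).-1 = L s)%N by lia.
rewrite !nth_chain_l // (exits_dvd sP) (Wstar_nth0 Ws) sL mulf_neq0 //.
Qed.

Lemma exits_T1 N e s : e != 0 -> exits N e s -> T N s 1 = Some (L s).
Proof.
move=> e0 sP; have [Ws _ _ _] := sP.
by rewrite /= -[s in LHS]chain_nil (exits_next_hit e0 sP).
Qed.

(** The hitting times start afresh at the end of the first word. *)
Lemma T_chain N e s v i : e != 0 -> exits N e s -> Wstar v ->
  T N (chain s v) i.+1 = omap (addn (L s)) (T N v i).
Proof.
move=> e0 sP Wv; have [Ws L0 si sL] := sP.
elim: i => [|i IH]; first by rewrite /= (exits_next_hit e0 sP) //= addn0.
rewrite [LHS]/= -/(T N (chain s v) i.+1) IH /=.
case E: (T N v i) => [t|//]; have /andP[_ tL] := T_le E.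
rewrite /= /next_hit L_chain // subnDl -addnS iotaDl filter_map.
rewrite (_ : [seq _ <- _ | _] =
  [seq j <- iota t.+1 (L v - t) | (2 ^+ N %| v`_j)%Z && (v`_j != v`_t)]).
  by case: [seq _ <- _ | _].
apply: eq_in_filter => j; rewrite mem_iota => jP /=.
rewrite !nth_chain_r //; try lia.
rewrite (inj_eq (addIr _)); congr andb.
by rewrite rpredDr // (exits_dvd sP).
Qed.

(** * Masses of chains of words *)

Section Weights.
Context {R : realType}.
Variable u : R.

(** The words of level 0 are the unit steps, with weight 1; with this convention a
    word of level 1 is a chain of words of level 0, as at the higher levels. *)
Definition word_weight (N : nat) (w : seq int) : R :=
  if N is 0 then 1 else Pplus u N w.

(** The path [w] is cut by its level-[N] hitting times into [m] complete segments,
    of total weight [p].  The first hitting times being finite exactly up to index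
    [m] determines the length of the coarse-grained path. *)
Definition composite (N : nat) (w : seq int) (m : nat) (p : R) : Prop :=
  [/\ Wstar w,
      forall i, isSome (T N w i) = (i <= m)%N,
      (m <= L w)%N, N = 0%N -> L w = m
    & \prod_(1 <= j < m.+1) word_weight N (segment N w j) = p].

Lemma composite_nil N : composite N [:: 0] 0 1.
Proof.
split=> //; last by rewrite big_geq.
by elim=> [|i] //= IH; case: (T N [:: 0] i).
Qed.

Lemma composite_chain N e s v m p : (e == 1) || (e == -1) -> exits N e s ->
  composite N v m p ->
  composite N (chain s v) m.+1 (word_weight N [seq e * y | y <- s] * p).
Proof.
move=> e1 sP [Wv Tv mL N0 pE]; have [Ws L0 si sL] := sP.
have e0 : e != 0 by lia.
have sg : sgz (s`_(L s)) = e.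
  rewrite sL sgzM (@gtr0_sgz _ (2 ^+ N)) ?exprn_gt0 // mulr1.
  by case/orP: e1 => /eqP ->.
split.
- exact: Wstar_chain.
- case=> [//|i]; rewrite (T_chain _ e0 sP) // ltnS -Tv.
  by case: (T N v i).
- by rewrite L_chain //; lia.
- move=> NE; rewrite L_chain // N0 //; suff -> : L s = 1%N by lia.
  apply/eqP; rewrite eqn_leq L0 andbT leqNgt; apply/negP => L1.
  have := si 1%N L1; rewrite NE expr0.
  have : `|s`_0 - s`_1| = 1.
    move: Ws L1; rewrite /L; case: (s) => [//|a [|b t]] //=.
    by case/and3P => _ /eqP.
  by rewrite (Wstar_nth0 Ws); lia.
- rewrite big_nat_recl // -pE; congr (word_weight N _ * _).
    rewrite /segment /= (exits_next_hit e0 sP) //= subn0 !nth_chain_l //.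
    rewrite (Wstar_nth0 Ws) subr0 sg.
    apply: (@eq_from_nth _ 0); rewrite size_mkseq ?size_map ?size_Wstar // => i iL.
    rewrite nth_mkseq // (nth_map 0) ?size_Wstar //.
    by rewrite add0n nth_chain_l // subr0.
  rewrite [in LHS]big_nat [in RHS]big_nat.
  apply: eq_bigr => -[//|j] jm; congr (word_weight N _).
  have := Tv j; have := Tv j.+1; have -> : (j <= m)%N by lia.
  have -> : (j.+1 <= m)%N by lia.
  rewrite /segment -!pred_Sn !(T_chain _ e0 sP) //.
  case E1: (T N v j.+1) => [t1|//] _; case E0: (T N v j) => [t0|//] _ /=.
  have /andP[_ t1L] := T_le E1; have /andP[_ t0L] := T_le E0.
  rewrite /mkseq subnDl; apply/eq_in_map => i; rewrite mem_iota => iL.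
  rewrite -addnA !nth_chain_r //; try lia.
  by congr (sgz _ * _); ring.
Qed.

(** The coarse-grained path enters the mass through its length [m] only. *)
Lemma Pplus_composite N w m p : composite N w m p ->
  Pplus u N.+1 w = u ^+ (m - 2) * x_ u ^+ (m - 1) * p.
Proof.
case=> Ww Tw mL; case: N Tw => [|N] Tw N0 pE /=.
  rewrite /P1plus N0 //; rewrite -pE big1 ?mulr1 //.
suff LQ : L (Q N.+1 w) = m by rewrite /P1plus LQ -[RHS]mulrA -pE mulrA.
rewrite /L /Q size_map size_pmap.
rewrite (eq_count (a2 := fun i => (i < m.+1)%N)); last by move=> i; rewrite Tw.
rewrite size_Wstar // -[X in iota _ X](subnKC (_ : (m.+1 <= (L w).+1)%N)) //.
rewrite iotaD count_cat add0n.
rewrite (eq_in_count (a2 := predT)) ?count_predT ?size_iota; last first.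
  by move=> i; rewrite mem_iota /= add0n => ->.
rewrite (eq_in_count (a2 := pred0)) ?count_pred0 ?addn0 //.
by move=> i; rewrite mem_iota => iP /=; apply/negbTE; lia.
Qed.

End Weights.

(** * First-exit words *)

Definition opp_path (s : seq int) : seq int := [seq - y | y <- s].
Definition up_up s1 s2 := chain s1 s2.
Definition up_down s1 s2 v := chain s1 (chain (opp_path s2) v).
Definition down_up s1 s2 v := chain (opp_path s1) (chain s2 v).

(** The loop structure of the first-exit words: the coarse-grained path starts with
    two steps up, which end it, or returns to 0 after two steps and starts afresh.  Having the rest [v] as an argument, rather than a list of loops, turns
    the geometric series over the number of loops into a linear equation. *)
Inductive exit_word : nat -> seq int -> Prop :=
| exit_word_unit : exit_word 0 [:: 0; 1]
| exit_word_up_up N s1 s2 : exit_word N s1 -> exit_word N s2 -> exit_word N.+1 (up_up s1 s2)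
| exit_word_up_down N s1 s2 v :
    exit_word N s1 -> exit_word N s2 -> exit_word N.+1 v -> exit_word N.+1 (up_down s1 s2 v)
| exit_word_down_up N s1 s2 v :
    exit_word N s1 -> exit_word N s2 -> exit_word N.+1 v -> exit_word N.+1 (down_up s1 s2 v).

Lemma opp_pathK : involutive opp_path.
Proof. by move=> s; rewrite /opp_path -map_comp map_id_in // => y _ /=; rewrite opprK. Qed.

Lemma L_opp_path s : L (opp_path s) = L s.
Proof. by rewrite /L size_map. Qed.

Lemma nth_opp_path s i : (opp_path s)`_i = - s`_i.
Proof.
have [iL|iL] := ltnP i (size s); first by rewrite (nth_map 0).
by rewrite !nth_default ?size_map // oppr0.
Qed.

Lemma Wstar_opp_path s : Wstar s -> Wstar (opp_path s).
Proof.
case: s => //= a s /andP[/eqP -> ps]; rewrite oppr0 eqxx /=.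
rewrite -[X in path _ X]oppr0 path_map.
by apply: sub_path ps => p q /= /eqP <-; apply/eqP; lia.
Qed.

Lemma exits_opp_path N e s : exits N e s -> exits N (- e) (opp_path s).
Proof.
case=> Ws L0 si sL; split; rewrite ?L_opp_path //; first exact: Wstar_opp_path.
  by move=> i iL; rewrite nth_opp_path normrN si.
by rewrite nth_opp_path sL mulNr.
Qed.

Lemma exits_le N e s i : (e == 1) || (e == -1) -> exits N e s -> `|s`_i| <= 2 ^+ N.
Proof.
move=> e1 [Ws L0 si sL]; case: (ltngtP i (L s)) => [/si/ltW //|iL|->].
  by rewrite nth_default ?normr0 ?exprn_ge0 // size_Wstar.
by rewrite sL; case/orP: e1 => /eqP ->; rewrite ?mulN1r ?normrN ?mul1r ger0_norm.
Qed.

(** The offset [c] is the position at which the path starts, so that the lemma can be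
    applied to each piece of a chain in turn. *)
Lemma inside_chain N e s v c : (e == 1) || (e == -1) -> exits N e s ->
  Wstar v -> `|c| <= 2 ^+ N -> `|c + e * 2 ^+ N| < 2 ^+ N.+1 ->
  (forall i, (i < L v)%N -> `|v`_i + (c + e * 2 ^+ N)| < 2 ^+ N.+1) ->
  forall i, (i < L (chain s v))%N -> `|(chain s v)`_i + c| < 2 ^+ N.+1.
Proof.
move=> e1 sP Wv c1 c2 vi i; have [Ws L0 si sL] := sP.
rewrite L_chain // => iL; case: (ltngtP i (L s)) => [is_|is_|->].
- rewrite nth_chain_l ?(ltnW is_) //; have := si _ is_; rewrite exprS.
  move: (2 ^+ N) c1 => X; lia.
- have -> : (i = L s + (i - L s))%N by lia.
  rewrite nth_chain_r //; last by lia.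
  by rewrite sL addrAC -addrA vi; lia.
- by rewrite nth_chain_l // sL addrC.
Qed.

Lemma exits_up_up N s1 s2 : exits N 1 s1 -> exits N 1 s2 ->
  exits N.+1 1 (up_up s1 s2).
Proof.
move=> h1 h2; have [W1 L1 i1 e1] := h1; have [W2 L2 i2 e2] := h2.
have p0 := exprn_gt0 N (isT : 0 < 2 :> int).
split; first exact: Wstar_chain; rewrite ?L_chain //.
- lia.
- rewrite -L_chain // => i iL; rewrite -[X in `|X|]addr0.
  apply: (inside_chain _ h1) iL => //; rewrite ?exprS.
  + by move: (2 ^+ N) p0 => X; lia.
  + by move: (2 ^+ N) p0 => X; lia.
  + by move=> j /i2; move: (2 ^+ N) => X; lia.
- by rewrite nth_chain_r // e1 e2 exprS; lia.
Qed.

Lemma exits_loop N e s1 s2 v : (e == 1) || (e == -1) ->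
  exits N e s1 -> exits N (- e) s2 -> exits N.+1 1 v ->
  exits N.+1 1 (chain s1 (chain s2 v)).
Proof.
move=> e1 h1 h2 hv; have [W1 L1 i1 E1] := h1; have [W2 L2 i2 E2] := h2.
have [Wv Lv iv ev] := hv; have Wc := Wstar_chain W2 Wv.
have e1' : (- e == 1) || (- e == -1) by lia.
have p0 := exprn_gt0 N (isT : 0 < 2 :> int).
split; first exact: Wstar_chain; rewrite ?L_chain //.
- lia.
- rewrite -!L_chain // => i iL; rewrite -[X in `|X|]addr0.
  apply: (inside_chain e1 h1) iL => //; rewrite ?exprS.
  + by move: (2 ^+ N) p0 => X; lia.
  + by case/orP: e1 => /eqP ->; move: (2 ^+ N) p0 => X; lia.
  + rewrite -exprS; apply: (inside_chain e1' h2) => //; rewrite ?exprS.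
    * by case/orP: e1 => /eqP ->; move: (2 ^+ N) p0 => X; lia.
    * by rewrite add0r mulNr subrr normr0; move: (2 ^+ N) p0 => X; lia.
    * by move=> j /iv; rewrite add0r mulNr subrr addr0 exprS.
- by rewrite nth_chain_r ?L_chain // nth_chain_r // E1 E2 ev mulNr subrK.
Qed.

Lemma exit_word_exits N s : exit_word N s -> exits N 1 s.
Proof.
elim=> {N s} [|N s1 s2 _ h1 _ h2|N s1 s2 v _ h1 _ h2 _ hv|N s1 s2 v _ h1 _ h2 _ hv].
- by split=> // -[|i] //=; rewrite normr0.
- exact: exits_up_up.
- exact: exits_loop (exits_opp_path h2) hv.
- by apply: exits_loop (exits_opp_path h1) _ hv; rewrite ?opprK.
Qed.

Lemma exit_word_exits_opp N s : exit_word N s -> exits N (-1) (opp_path s).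
Proof. by move=> /exit_word_exits/exits_opp_path. Qed.

Lemma exit_word_Wstar N s : exit_word N s -> Wstar s.
Proof. by move=> /exit_word_exits[]. Qed.

Lemma exit_word_Wplus N s : exit_word N s -> Wplus N s.
Proof.
move=> /exit_word_exits sP; have [Ws _ _ sL] := sP.
by rewrite /Wplus Ws (exits_T1 _ sP) // eqxx sL mul1r eqxx.
Qed.

Lemma exit_word_Wminus N s : exit_word N s -> Wminus N (opp_path s).
Proof.
move=> /exit_word_exits_opp sP; have [Ws _ _ sL] := sP.
by rewrite /Wminus Ws (exits_T1 _ sP) // eqxx sL mulN1r eqxx.
Qed.

(** First-exit words form a prefix code: the end of [s] is the first time of exit. *)
Lemma chain_inj N e e' s s' v v' : e != 0 -> e' != 0 ->
  exits N e s -> exits N e' s' -> Wstar v -> Wstar v' ->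
  chain s v = chain s' v' -> s = s' /\ v = v'.
Proof.
move=> e0 e0' sP sP' Wv Wv' E; have [Ws _ _ _] := sP; have [Ws' _ _ _] := sP'.
have LE : L s = L s'.
  by have := exits_next_hit e0 sP Wv; rewrite E (exits_next_hit e0' sP') // => -[].
have sz : size s = size s' by rewrite !size_Wstar // LE.
move/eqP: E; rewrite eqseq_cat // => /andP[/eqP <- /eqP vE]; split=> //.
rewrite (Wstar_cons Wv) (Wstar_cons Wv'); congr cons.
by apply: inj_map vE; exact: addIr.
Qed.

Lemma exits_sign_neq N s s' : exits N 1 s -> exits N (-1) s' -> s <> s'.
Proof.
move=> [_ _ _ sL] [_ _ _ sL'] E; move: sL; rewrite E sL'.
by have := exprn_gt0 N (isT : 0 < 2 :> int); lia.
Qed.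

(** * Words staying above a level *)

Definition above (k : nat) (w : seq int) : bool := all (fun y : int => - k%:Z <= y) w.
Definition words_above (N k : nat) : set (seq int) :=
  [set w | exit_word N w /\ above k w].

Lemma exits_all_ge N e s (c : int) : (e == 1) || (e == -1) -> exits N e s ->
  c <= - 2 ^+ N -> all (fun y : int => c <= y) s.
Proof.
move=> e1 sP cN; apply/allP => y ys; rewrite /= -(nth_index 0 ys).
have key (d X z : int) : d <= - X -> `|z| <= X -> d <= z by lia.
exact: key cN (exits_le _ e1 sP).
Qed.

Lemma exit_word_all_ge N s (c : int) : exit_word N s -> c < - 2 ^+ N + 2 ->
  all (fun y : int => c <= y) s.
Proof.
move=> /exit_word_exits sP cN; have [Ws L0 si sL] := sP; apply/allP => y ys.
have : (index y s <= L s)%N by rewrite -ltnS -size_Wstar // index_mem.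
rewrite /= -[X in _ -> is_true (_ <= X)](nth_index 0 ys).
rewrite leq_eqVlt => /orP[/eqP->|/si].
  have key (d X : int) : d < - X + 2 -> 0 < X -> d <= 1 * X by lia.
  by rewrite sL; apply: key cN _; exact: exprn_gt0.
have key (d X z : int) : d < - X + 2 -> `|z| < X -> d <= z by lia.
exact: key cN.
Qed.

Lemma above_up_up N k s1 s2 : exit_word N s1 -> exit_word N s2 ->
  above k (up_up s1 s2) = above k s1.
Proof.
move=> h1 h2; have [W1 _ _ e1] := exit_word_exits h1.
rewrite /above all_ge_chain ?(exit_word_Wstar h2) // (exit_word_all_ge h2) ?andbT //.
by rewrite e1; have := exprn_gt0 N (isT : 0 < 2 :> int); lia.
Qed.

(** The down step starts at [2 ^+ N] and stays above 0, and the final path [v] starts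
    at 0 again. *)
Lemma above_up_down N k s1 s2 v :
  exit_word N s1 -> exit_word N s2 -> exit_word N.+1 v ->
  above k (up_down s1 s2 v) = above k s1 && above k v.
Proof.
move=> h1 h2 hv; have [W1 _ _ e1] := exit_word_exits h1.
have [W2 _ _ e2] := exit_word_exits_opp h2.
have Wv := exit_word_Wstar hv.
rewrite /above all_ge_chain ?Wstar_chain // all_ge_chain // e1 e2.
rewrite (exits_all_ge _ (exit_word_exits_opp h2)) //=; last by lia.
by congr andb; apply: eq_all => y; lia.
Qed.

(** The down step reaches [- 2 ^+ N], and the up step back starts from there. *)
Lemma above_down_up N k s1 s2 v :
  exit_word N s1 -> exit_word N s2 -> exit_word N.+1 v ->
  above k (down_up s1 s2 v) = (2 ^ N <= k)%N && above (k - 2 ^ N) s2 && above k v.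
Proof.
move=> h1 h2 hv; have [W1 _ _ e1] := exit_word_exits_opp h1.
have [W2 _ _ e2] := exit_word_exits h2.
have Wv := exit_word_Wstar hv.
have p2 : (2 ^ N)%N%:Z = 2 ^+ N :> int by rewrite -natrX natz.
rewrite /above all_ge_chain ?Wstar_chain // all_ge_chain // e1 e2.
have [kN|kN] := leqP (2 ^ N) k.
  rewrite (exits_all_ge _ (exit_word_exits_opp h1)) //=; last by lia.
  by congr andb; apply: eq_all => y; lia.
suff -> : all (fun y : int => - k%:Z <= y) (opp_path s1) = false by [].
apply/negbTE/allPn; exists (- 2 ^+ N); last by lia.
by rewrite -mulN1r -e1 mem_nth // size_Wstar.
Qed.

Lemma above_top N s k : exit_word N s -> (2 ^ N <= k.+1)%N -> above k s.
Proof.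
move=> h kN; apply: (exit_word_all_ge h).
have p2 : (2 ^ N)%N%:Z = 2 ^+ N :> int by rewrite -natrX natz.
lia.
Qed.

(** A first-exit word cannot go below [- 2 ^+ N + 1]. *)
Lemma words_above_top N k : (2 ^ N <= k.+1)%N -> words_above N k = exit_word N.
Proof.
move=> kN; apply/seteqP; split=> w; first by case.
by move=> h; split=> //; exact: above_top h kN.
Qed.

Lemma words_above_lo N k : (k < 2 ^ N)%N ->
  words_above N.+1 k = [set up_up t.1 t.2 | t in words_above N k `*` exit_word N] `|`
             [set up_down t.1.1 t.1.2 t.2 |
                t in (words_above N k `*` exit_word N) `*` words_above N.+1 k].
Proof.
move=> kN; apply/seteqP; split=> [w [Vw]|w].
- inversion Vw; subst=> aw.
  + by left; exists (s1, s2) => //=; split=> //; split=> //; rewrite -(above_up_up _ H0 H1).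
  + right; exists ((s1, s2), v) => //; move: aw; rewrite (above_up_down _ H0 H1 H2).
    by case/andP.
  + by move: aw; rewrite (above_down_up _ H0 H1 H2) leqNgt kN.
- case=> -[] => [[s1 s2] [[/= V1 a1] V2] <-|[[s1 s2] v] [[[/= V1 a1] V2] [Vv av]] <-].
  + by split; [exact: exit_word_up_up|rewrite (above_up_up _ V1 V2)].
  + by split; [exact: exit_word_up_down|rewrite (above_up_down _ V1 V2 Vv) a1].
Qed.

Lemma words_above_hi N k : (2 ^ N <= k)%N ->
  words_above N.+1 k = [set up_up t.1 t.2 | t in exit_word N `*` exit_word N] `|`
             ([set up_down t.1.1 t.1.2 t.2 |
                t in (exit_word N `*` exit_word N) `*` words_above N.+1 k] `|`
              [set down_up t.1.1 t.1.2 t.2 |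
                t in (exit_word N `*` words_above N (k - 2 ^ N)) `*` words_above N.+1 k]).
Proof.
move=> kN; apply/seteqP; split=> [w [Vw]|w].
- inversion Vw; subst=> aw.
  + by left; exists (s1, s2).
  + right; left; exists ((s1, s2), v) => //; move: aw; rewrite (above_up_down _ H0 H1 H2).
    by case/andP.
  + right; right; exists ((s1, s2), v) => //.
    by move: aw; rewrite (above_down_up _ H0 H1 H2) => /andP[/andP[]].
- case=> [|[]] -[] => [[s1 s2] [/= V1 V2] <-|[[s1 s2] v] [[/= V1 V2] [Vv av]] <-|
    [[s1 s2] v] [[/= V1 [V2 a2]] [Vv av]] <-].
  + split; [exact: exit_word_up_up|rewrite (above_up_up _ V1 V2)].
    by apply: above_top V1 _; lia.
  + split; [exact: exit_word_up_down|rewrite (above_up_down _ V1 V2 Vv) av andbT].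
    by apply: above_top V1 _; lia.
  + by split; [exact: exit_word_down_up|rewrite (above_down_up _ V1 V2 Vv) kN a2].
Qed.

Lemma up_up_inj N s1 s2 t1 t2 :
  exit_word N s1 -> exit_word N s2 -> exit_word N t1 -> exit_word N t2 ->
  up_up s1 s2 = up_up t1 t2 -> s1 = t1 /\ s2 = t2.
Proof.
move=> V1 V2 V3 V4; have W2 := exit_word_Wstar V2; have W4 := exit_word_Wstar V4.
exact: (chain_inj _ _ (exit_word_exits V1) (exit_word_exits V3)).
Qed.

Lemma up_down_inj N s1 s2 t1 t2 v w :
  exit_word N s1 -> exit_word N s2 -> exit_word N t1 -> exit_word N t2 ->
  exit_word N.+1 v -> exit_word N.+1 w ->
  up_down s1 s2 v = up_down t1 t2 w -> [/\ s1 = t1, s2 = t2 & v = w].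
Proof.
move=> V1 V2 V3 V4 Vv Vw.
have Wv := exit_word_Wstar Vv; have Ww := exit_word_Wstar Vw.
have [W2 _ _ _] := exit_word_exits_opp V2; have [W4 _ _ _] := exit_word_exits_opp V4.
move=> /(chain_inj _ _ (exit_word_exits V1) (exit_word_exits V3)) [] //;
  try exact: Wstar_chain.
move=> -> /(chain_inj _ _ (exit_word_exits_opp V2) (exit_word_exits_opp V4)) [] // E ->.
by rewrite -(opp_pathK s2) E opp_pathK.
Qed.

Lemma down_up_inj N s1 s2 t1 t2 v w :
  exit_word N s1 -> exit_word N s2 -> exit_word N t1 -> exit_word N t2 ->
  exit_word N.+1 v -> exit_word N.+1 w ->
  down_up s1 s2 v = down_up t1 t2 w -> [/\ s1 = t1, s2 = t2 & v = w].
Proof.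
move=> V1 V2 V3 V4 Vv Vw.
have Wv := exit_word_Wstar Vv; have Ww := exit_word_Wstar Vw.
have W2 := exit_word_Wstar V2; have W4 := exit_word_Wstar V4.
move=> /(chain_inj _ _ (exit_word_exits_opp V1) (exit_word_exits_opp V3)) [] //;
  try exact: Wstar_chain.
move=> E /(chain_inj _ _ (exit_word_exits V2) (exit_word_exits V4)) [] // -> ->.
by split=> //; rewrite -(opp_pathK s1) E opp_pathK.
Qed.

Lemma up_up_neq_up_down N s1 s2 t1 t2 v :
  exit_word N s1 -> exit_word N s2 -> exit_word N t1 -> exit_word N t2 ->
  exit_word N.+1 v -> up_up s1 s2 <> up_down t1 t2 v.
Proof.
move=> V1 V2 V3 V4 Vv; have Wv := exit_word_Wstar Vv.
have [W4 _ _ _] := exit_word_exits_opp V4.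
move=> /(chain_inj _ _ (exit_word_exits V1) (exit_word_exits V3)) [] //.
- exact: exit_word_Wstar V2.
- exact: Wstar_chain.
move=> _; rewrite -[X in X = _]chain_nil.
move=> /(chain_inj _ _ (exit_word_exits V2) (exit_word_exits_opp V4)) [] // E.
by case: (exits_sign_neq (exit_word_exits V2) (exit_word_exits_opp V4)).
Qed.

Lemma up_up_neq_down_up N s1 s2 t1 t2 v :
  exit_word N s1 -> exit_word N s2 -> exit_word N t1 -> exit_word N t2 ->
  exit_word N.+1 v -> up_up s1 s2 <> down_up t1 t2 v.
Proof.
move=> V1 V2 V3 V4 Vv; have Wv := exit_word_Wstar Vv.
move=> /(chain_inj _ _ (exit_word_exits V1) (exit_word_exits_opp V3)) [] //.
- exact: exit_word_Wstar V2.
- exact/Wstar_chain/Wv/exit_word_Wstar/V4.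
by move=> /(exits_sign_neq (exit_word_exits V1) (exit_word_exits_opp V3)).
Qed.

Lemma up_down_neq_down_up N s1 s2 t1 t2 v w :
  exit_word N s1 -> exit_word N s2 -> exit_word N t1 -> exit_word N t2 ->
  exit_word N.+1 v -> exit_word N.+1 w -> up_down s1 s2 v <> down_up t1 t2 w.
Proof.
move=> V1 V2 V3 V4 Vv Vw; have Wv := exit_word_Wstar Vv; have Ww := exit_word_Wstar Vw.
have [W2 _ _ _] := exit_word_exits_opp V2.
move=> /(chain_inj _ _ (exit_word_exits V1) (exit_word_exits_opp V3)) [] //.
- exact: Wstar_chain.
- exact/Wstar_chain/Ww/exit_word_Wstar/V4.
by move=> /(exits_sign_neq (exit_word_exits V1) (exit_word_exits_opp V3)).
Qed.

(** * Unordered sums *)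

Section Esum.
Context {R : realType}.
Local Open Scope ereal_scope.

Lemma esum_setU (T : choiceType) (A B : set T) (f : T -> \bar R) :
  [disjoint A & B] -> (forall x, 0 <= f x) ->
  \esum_(x in A `|` B) f x = \esum_(x in A) f x + \esum_(x in B) f x.
Proof.
move=> /disj_setPS AB f0; rewrite (esumID A) //; congr (_ + _).
  by congr esum; apply/setIidPr; exact: subsetUl.
rewrite setIUl setICr set0U; congr esum.
by apply/setIidPl => x Bx Ax; exact: (AB x).
Qed.

Lemma esumZl (T : choiceType) (A : set T) (c : R) (f : T -> \bar R) :
  (0 <= c)%R -> (forall x, 0 <= f x) ->
  \esum_(x in A) (c%:E * f x) = c%:E * \esum_(x in A) f x.
Proof.
move=> c0 f0; rewrite /esum -ereal_supZl //; last first.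
  by apply/set0P; exists (\sum_(x \in set0) f x); exists set0 => //; exact: fsets_set0.
congr ereal_sup; apply/seteqP; split=> y /=.
  move=> [X XA <-]; exists (\sum_(x \in X) f x); first by exists X.
  by rewrite ge0_mule_fsumr.
by move=> [_ [X XA <-] <-]; exists X => //; rewrite ge0_mule_fsumr.
Qed.

Lemma esum_prod (T T' : choiceType) (A : set T) (B : set T') (p : T -> R)
    (q : T' -> R) (a b : R) :
  (forall x, (0 <= p x)%R) -> (forall x, (0 <= q x)%R) ->
  \esum_(x in A) (p x)%:E = a%:E -> \esum_(y in B) (q y)%:E = b%:E ->
  \esum_(t in A `*` B) (p t.1 * q t.2)%:E = (a * b)%:E.
Proof.
move=> p0 q0 pa qb.
have b0 : (0 <= b)%R by rewrite -lee_fin -qb; apply: esum_ge0 => x _; rewrite lee_fin.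
rewrite -(esum_esum (J := fun=> B) (a := fun x y => (p x * q y)%:E)); last first.
  by move=> x y _ _; rewrite lee_fin mulr_ge0.
have qf y : 0 <= (q y)%:E by rewrite lee_fin.
under eq_esum => x _.
  under eq_esum do rewrite EFinM.
  rewrite (esumZl _ (p0 x) qf) qb muleC.
  over.
have pf x : 0 <= (p x)%:E by rewrite lee_fin.
by rewrite (esumZl _ b0 pf) pa -EFinM mulrC.
Qed.

End Esum.

(** * Masses of sets of first-exit words *)

Section Weights.
Context {R : realType}.
Variable u : R.
Hypothesis u0 : 0 <= u.
Local Notation x := (x_ u).
Local Notation wgt := (word_weight u).

Lemma x_gt0 : 0 < x.
Proof.
rewrite /x_ divr_gt0 // ltr_wpDr ?sqrtr_ge0 //.
Qed.

Lemma Pplus_ge0 N w : 0 <= Pplus u N w.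
Proof.
have P1 v : 0 <= P1plus u v by rewrite mulr_ge0 ?exprn_ge0 ?(ltW x_gt0).
elim: N w => [//|N IH] w /=; case: ifP => // _.
by rewrite mulr_ge0 // prodr_ge0.
Qed.

Lemma word_weight_ge0 N w : 0 <= wgt N w.
Proof. by case: N => [|N]; [exact: ler01|exact: Pplus_ge0]. Qed.

Lemma map_mul1 (s : seq int) : [seq 1 * y | y <- s] = s.
Proof. by rewrite map_id_in // => y _; rewrite mul1r. Qed.

Lemma map_mulN1 (s : seq int) : [seq -1 * y | y <- opp_path s] = s.
Proof. by rewrite -[RHS]opp_pathK; apply: eq_map => y; rewrite mulN1r. Qed.

(** At least two steps are needed to reach [2 ^+ N.+1]; this keeps the subtractions
    in the exponents of the mass from being truncated. *)
Lemma exit_word_composite N v : exit_word N.+1 v ->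
  exists m p, composite u N v m.+2 p.
Proof.
move E: N.+1 => M vV; elim: vV N E => {M v}//.
- move=> N s1 s2 V1 _ V2 _ _ [->]; rewrite /up_up -[s2]chain_nil.
  do 2![eexists]; apply: (composite_chain (e := 1)) => //; first exact: exit_word_exits.
  by apply: (composite_chain (e := 1)); [|exact: exit_word_exits|exact: composite_nil].
- move=> N s1 s2 v V1 _ V2 _ Vv IH _ [->]; have [m [p vP]] := IH _ erefl.
  do 2![eexists]; apply: (composite_chain (e := 1)) => //; first exact: exit_word_exits.
  by apply: (composite_chain (e := -1)) vP; [|exact: exit_word_exits_opp].
- move=> N s1 s2 v V1 _ V2 _ Vv IH _ [->]; have [m [p vP]] := IH _ erefl.
  do 2![eexists]; apply: (composite_chain (e := -1)) => //; first exact: exit_word_exits_opp.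
  by apply: (composite_chain (e := 1)) vP; [|exact: exit_word_exits].
Qed.

Lemma Pplus_up_up N s1 s2 : exit_word N s1 -> exit_word N s2 ->
  Pplus u N.+1 (up_up s1 s2) = x * (wgt N s1 * wgt N s2).
Proof.
move=> V1 V2; rewrite /up_up -[in LHS](chain_nil s2).
have h := composite_chain (e := 1) isT (exit_word_exits V2) (composite_nil u N).
rewrite (Pplus_composite (composite_chain (e := 1) isT (exit_word_exits V1) h)).
by rewrite !map_mul1 mulr1 subnn subSS subn0 expr0 expr1 mul1r.
Qed.

Lemma Pplus_up_down N s1 s2 v :
  exit_word N s1 -> exit_word N s2 -> exit_word N.+1 v ->
  Pplus u N.+1 (up_down s1 s2 v) =
  u ^+ 2 * x ^+ 2 * (wgt N s1 * wgt N s2 * Pplus u N.+1 v).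
Proof.
move=> V1 V2 /exit_word_composite [m [p vP]]; rewrite (Pplus_composite vP).
have h := composite_chain (e := -1) isT (exit_word_exits_opp V2) vP.
rewrite (Pplus_composite (composite_chain (e := 1) isT (exit_word_exits V1) h)).
rewrite map_mul1 map_mulN1 !subSS !subn0 !exprS; ring.
Qed.

Lemma Pplus_down_up N s1 s2 v :
  exit_word N s1 -> exit_word N s2 -> exit_word N.+1 v ->
  Pplus u N.+1 (down_up s1 s2 v) =
  u ^+ 2 * x ^+ 2 * (wgt N s1 * wgt N s2 * Pplus u N.+1 v).
Proof.
move=> V1 V2 /exit_word_composite [m [p vP]]; rewrite (Pplus_composite vP).
have h := composite_chain (e := 1) isT (exit_word_exits V2) vP.
rewrite (Pplus_composite (composite_chain (e := -1) isT (exit_word_exits_opp V1) h)).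
rewrite map_mul1 map_mulN1 !subSS !subn0 !exprS; ring.
Qed.

Definition word_mass N (D : set (seq int)) : \bar R := (\esum_(w in D) (wgt N w)%:E)%E.

Lemma word_mass_up_up N (D D' : set (seq int)) a b :
  D `<=` exit_word N -> D' `<=` exit_word N ->
  word_mass N D = a%:E -> word_mass N D' = b%:E ->
  word_mass N.+1 [set up_up t.1 t.2 | t in D `*` D'] = (x * (a * b))%:E.
Proof.
move=> DV DV' Ea Eb; rewrite /word_mass esum_image; last first.
  move=> [s1 s2] [t1 t2]; rewrite !inE /= => -[D1 D2] [D3 D4].
  by move=> /(up_up_inj (DV _ D1) (DV' _ D2) (DV _ D3) (DV' _ D4)) [-> ->].
rewrite (eq_esum (b := fun t => x%:E * (wgt N t.1 * wgt N t.2)%:E)%E); last first.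
  move=> t [/DV V1 /DV' V2]; rewrite -EFinM; congr EFin; exact: Pplus_up_up.
rewrite esumZl ?(ltW x_gt0) //; last first.
  by move=> t; rewrite lee_fin mulr_ge0 ?word_weight_ge0.
by rewrite (esum_prod _ _ Ea Eb) // => w; exact: word_weight_ge0.
Qed.

Lemma word_mass_loop (f : seq int -> seq int -> seq int -> seq int)
    N (D D' D'' : set (seq int)) a b c :
  (forall s1 s2 v, exit_word N s1 -> exit_word N s2 -> exit_word N.+1 v ->
    Pplus u N.+1 (f s1 s2 v) =
    u ^+ 2 * x ^+ 2 * (wgt N s1 * wgt N s2 * Pplus u N.+1 v)) ->
  (forall s1 s2 t1 t2 v w, 
  exit_word N s1 -> exit_word N s2 -> exit_word N t1 -> exit_word N t2 ->
    exit_word N.+1 v -> exit_word N.+1 w ->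
    f s1 s2 v = f t1 t2 w -> [/\ s1 = t1, s2 = t2 & v = w]) ->
  D `<=` exit_word N -> D' `<=` exit_word N -> D'' `<=` exit_word N.+1 ->
  word_mass N D = a%:E -> word_mass N D' = b%:E -> word_mass N.+1 D'' = c%:E ->
  word_mass N.+1 [set f t.1.1 t.1.2 t.2 | t in (D `*` D') `*` D''] =
  (u ^+ 2 * x ^+ 2 * (a * b * c))%:E.
Proof.
move=> Pf fI DV DV' DV'' Ea Eb Ec; rewrite /word_mass esum_image; last first.
  move=> [[s1 s2] v] [[t1 t2] w]; rewrite !inE /=.
  move=> [[/DV D1 /DV' D2] /DV'' D3] [[/DV D4 /DV' D5] /DV'' D6].
  by move=> /(fI _ _ _ _ _ _ D1 D2 D4 D5 D3 D6) [-> -> ->].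
rewrite (eq_esum (b := fun t => (u ^+ 2 * x ^+ 2)%:E *
    (wgt N t.1.1 * wgt N t.1.2 * Pplus u N.+1 t.2)%:E)%E); last first.
  move=> t [[/DV V1 /DV' V2] /DV'' V3]; rewrite -EFinM; congr EFin; exact: Pf.
rewrite esumZl ?mulr_ge0 ?sqr_ge0 //; last first.
  by move=> t; rewrite lee_fin !mulr_ge0 ?word_weight_ge0 ?Pplus_ge0.
have Eab : (\esum_(t in D `*` D') (wgt N t.1 * wgt N t.2)%:E = (a * b)%:E)%E.
  by rewrite (esum_prod _ _ Ea Eb) // => w; exact: word_weight_ge0.
rewrite (esum_prod _ _ Eab Ec) // => w; first by rewrite mulr_ge0 ?word_weight_ge0.
exact: Pplus_ge0.
Qed.

Lemma words_above_sub N k : words_above N k `<=` exit_word N. Proof. by move=> w []. Qed.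

(** The equation for a mass [s] from the decomposition of the words; the sum of the
    geometric series is read off from it, once [s] is known to be finite. *)
Lemma word_mass_lo N k g t s : (k < 2 ^ N)%N ->
  word_mass N (words_above N k) = g%:E -> word_mass N (exit_word N) = t%:E ->
  word_mass N.+1 (words_above N.+1 k) = s%:E ->
  s = x * (g * t) + u ^+ 2 * x ^+ 2 * (g * t * s).
Proof.
move=> kN Eg Et Es; apply: EFin_inj.
rewrite -[LHS]Es {1}words_above_lo // /word_mass esum_setU.
- rewrite EFinD -(word_mass_up_up _ _ Eg Et) //; last exact: words_above_sub.
  rewrite -(word_mass_loop (@Pplus_up_down N) (@up_down_inj N) _ _ _ Eg Et Es) //;
    exact: words_above_sub.
- apply/disj_setPS => w [[[s1 s2] [/= [V1 _] V2] <-]].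
  move=> [[[t1 t2] v] [[/= [V3 _] V4] [V5 _]]] /esym.
  exact: up_up_neq_up_down V1 V2 V3 V4 V5.
- by move=> w; rewrite lee_fin word_weight_ge0.
Qed.

Lemma word_mass_hi N k g t s : (2 ^ N <= k)%N ->
  word_mass N (words_above N (k - 2 ^ N)) = g%:E -> word_mass N (exit_word N) = t%:E ->
  word_mass N.+1 (words_above N.+1 k) = s%:E ->
  s = x * (t * t) + (u ^+ 2 * x ^+ 2 * (t * t * s) + u ^+ 2 * x ^+ 2 * (t * g * s)).
Proof.
move=> kN Eg Et Es; apply: EFin_inj.
rewrite -[LHS]Es {1}words_above_hi // /word_mass !esum_setU.
- rewrite !EFinD -(word_mass_up_up _ _ Et Et) //.
  rewrite -(word_mass_loop (@Pplus_up_down N) (@up_down_inj N) _ _ _ Et Et Es) //;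
    last exact: words_above_sub.
  rewrite -(word_mass_loop (@Pplus_down_up N) (@down_up_inj N) _ _ _ Et Eg Es) //;
    exact: words_above_sub.
- apply/disj_setPS => w [[[[s1 s2] v] [[/= V1 V2] [V5 _]] <-]].
  move=> [[[t1 t2] v'] [[/= V3 [V4 _]] [V6 _]]] /esym.
  exact: up_down_neq_down_up V1 V2 V3 V4 V5 V6.
- by move=> w; rewrite lee_fin word_weight_ge0.
- apply/disj_setPS => w [[[s1 s2] [/= V1 V2] <-]] [].
    move=> [[[t1 t2] v] [[/= V3 V4] [V5 _]]] /esym.
    exact: up_up_neq_up_down V1 V2 V3 V4 V5.
  move=> [[[t1 t2] v] [[/= V3 [V4 _]] [V5 _]]] /esym.
  exact: up_up_neq_down_up V1 V2 V3 V4 V5.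
- by move=> w; rewrite lee_fin word_weight_ge0.
Qed.

End Weights.

(** * The range of a path starting with a first-exit word *)

Lemma cylinder_hit n e w om i : exits n e w -> cylinder w om ->
  (i < L w)%N -> om i != 2 ^+ n /\ om i != - 2 ^+ n.
Proof.
move=> [Ww L0 si _] cw iL; rewrite cw ?(ltnW iL) //; have := si i iL.
by move: (2 ^+ n : int) => X; lia.
Qed.

(** Nearest-neighbour paths do not skip integers. *)
Lemma path_ivt (om : Winfty) (x : int) j m : (j <= m)%N -> om j <= x -> x <= om m ->
  exists2 i, (j <= i <= m)%N & om i = x.
Proof.
elim: m => [|m IH].
  by rewrite leqn0 => /eqP -> h1 h2; exists 0%N => //; lia.
rewrite leq_eqVlt => /orP[/eqP <- h1 h2|jm h1 h2]; first by exists j; lia.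
have := pos_step om m; case: (leP x (om m)) => [xm|xm] st.
  by have [i iP <-] := IH jm h1 xm; exists i => //; lia.
by exists m.+1; lia.
Qed.

(** The visited points lie in the integer interval from [- k] to [2 ^ n - 1]. *)
Lemma Rn_le n w om k : exits n 1 w -> cylinder w om -> above k w ->
  (Rn n om <= 2 ^ n + k)%N.
Proof.
move=> wP cw aw; have [Ww L0 si sL] := wP.
have p2 : (2 ^ n)%N%:Z = 2 ^+ n :> int by rewrite -natrX natz.
rewrite -[leqRHS](size_iota 0) -(size_map (fun i : nat => i%:Z - k%:Z)).
apply: uniq_leq_size; first exact: fset_uniq.
move=> x; rewrite in_fset_set; last exact: finite_visited.
move=> /set_mem vx; have xn := visited_bound vx; case: vx => j [jx nh].
have jL : (j < L w)%N.
  rewrite ltnNge; apply/negP => /nh[]; rewrite cw // sL mul1r eqxx.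
  by [].
have xk : - k%:Z <= x.
  rewrite -jx cw ?(ltnW jL) //; move/allP: aw; apply.
  by rewrite mem_nth // size_Wstar // ltnS ltnW.
apply/mapP; exists (absz (x + k%:Z)); last by lia.
rewrite mem_iota add0n /=; lia.
Qed.

(** All integers between [- m] and [2 ^ n - 1] are visited on the way from the [j]-th
    position to the exit. *)
Lemma Rn_ge n w om m j : exits n 1 w -> cylinder w om ->
  (j <= L w)%N -> w`_j <= - m%:Z -> (2 ^ n + m <= Rn n om)%N.
Proof.
move=> wP cw jL wj; have [Ww L0 si sL] := wP.
have p2 : (2 ^ n)%N%:Z = 2 ^+ n :> int by rewrite -natrX natz.
rewrite -[leqLHS](size_iota 0) -(size_map (fun i : nat => i%:Z - m%:Z)).
apply: uniq_leq_size; first by rewrite map_inj_uniq ?iota_uniq // => p q; lia.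
move=> x /mapP[i]; rewrite mem_iota add0n /= => iP xE.
rewrite in_fset_set; last exact: finite_visited.
apply/mem_set; have [||l lP lx] := path_ivt (om := om) (x := x) jL.
- by rewrite cw //; lia.
- by rewrite cw // sL; lia.
exists l; split=> // l' l'l; apply: (cylinder_hit wP cw).
have : l != L w; last by lia.
by apply/eqP => E; move: lx; rewrite E cw // sL; lia.
Qed.

Lemma Rn_gt n w om k : exits n 1 w -> cylinder w om -> ~~ above k w ->
  (2 ^ n + k < Rn n om)%N.
Proof.
move=> wP cw /allPn[y yw yk]; have [Ww _ _ _] := wP.
rewrite -addnS; apply: (@Rn_ge n w om k.+1 (index y w) wP cw).
  by rewrite -ltnS -size_Wstar // index_mem.
rewrite nth_index //; lia.
Qed.

Lemma opp_step (om : Winfty) i : `|- om i - - om i.+1| = 1.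
Proof. by have := pos_step om i; lia. Qed.

Lemma opp_0 (om : Winfty) : - om 0%N = 0.
Proof. by rewrite pos0 oppr0. Qed.

(** The range is invariant under this reflection, which reduces the words ending at
    [- 2 ^ n] to those ending at [2 ^ n]. *)
Definition reflect_path (om : Winfty) : Winfty := MkWinfty (opp_0 om) (opp_step om).

Lemma Rn_reflect n om : Rn n (reflect_path om) = Rn n om.
Proof.
have -> : Rn n (reflect_path om) = #|` fset_set (-%R @` visited n om)|%fset.
  congr (size (fset_set _)); apply/seteqP; split=> x /=.
    move=> [j [/= jx nh]]; exists (- x); last by rewrite opprK.
    exists j; split; first by rewrite -jx opprK.
    by move=> i /nh [h1 h2]; rewrite -(inj_eq oppr_inj) h2 -(inj_eq oppr_inj) opprK.
  move=> [y [j [jy nh]] <-]; exists j; split=> /=; first by rewrite jy.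
  by move=> i /nh [h1 h2]; rewrite eqr_oppLR h2 eqr_opp h1.
rewrite fset_set_image; last exact: finite_visited.
by rewrite card_imfset //; exact: oppr_inj.
Qed.

Lemma cylinder_reflect w om : cylinder (opp_path w) om -> cylinder w (reflect_path om).
Proof. by move=> c j jL; rewrite /= c ?L_opp_path // nth_opp_path opprK. Qed.

Lemma measurable_cylinder w : Wstar w -> measurable (cylinder w).
Proof. by move=> Ww; apply: sub_sigma_algebra; exists w. Qed.

Lemma cylinder_disj n e e' w w' om : (e == 1) || (e == -1) -> (e' == 1) || (e' == -1) ->
  exits n e w -> exits n e' w' -> cylinder w om -> cylinder w' om -> w = w'.
Proof.
move=> e1 e1' wP wP' c c'; have [Ww L0 si sL] := wP; have [Ww' L0' si' sL'] := wP'.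
have hit e0 v : (e0 == 1) || (e0 == -1) -> exits n e0 v -> cylinder v om ->
    om (L v) = 2 ^+ n \/ om (L v) = - 2 ^+ n.
  move=> /orP[]/eqP -> [_ _ _ E] ->; rewrite // E.
    by left; rewrite mul1r.
  by right; rewrite mulN1r.
have LE : L w = L w'.
  case: (ltngtP (L w) (L w')) => // lt.
    have [/eqP h1 /eqP h2] := cylinder_hit wP' c' lt.
    by case: (hit _ _ e1 wP c).
  have [/eqP h1 /eqP h2] := cylinder_hit wP c lt.
  by case: (hit _ _ e1' wP' c').
apply: (@eq_from_nth _ 0); first by rewrite !size_Wstar // LE.
move=> i; rewrite size_Wstar // ltnS => iL.
by rewrite -c // -c' // -LE.
Qed.

(** * Iterating the functional equation *)

Section Constants.
Context {R : realType}.
Variable u : R.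
Local Notation x := (x_ u).
(** The weight of a loop of the coarse-grained path. *)
Definition loop_weight : R := u ^+ 2 * x_ u ^+ 2.
Local Notation a := loop_weight.

Lemma loop_weight_ge0 : 0 <= a. Proof. by rewrite mulr_ge0 ?sqr_ge0. Qed.

(** A form of the quadratic equation solved by [x_ u]; it says that the masses of the words of
    level 1 sum to 1. *)
Lemma x_loop_weight : x = 1 - 2 * a.
Proof.
rewrite /loop_weight /x_; set s := Num.sqrt _.
have s0 : 0 <= s := sqrtr_ge0 _.
have s2 : s ^+ 2 = 1 + 8 * u ^+ 2.
  by rewrite sqr_sqrtr // addr_ge0 // mulr_ge0 // sqr_ge0.
have -> : u ^+ 2 = (s ^+ 2 - 1) / 8 by rewrite s2; field.
by field; lra.
Qed.

Lemma loop_weight_lt : a < 2^-1.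
Proof.
have x0 := x_gt0 u; have xE := x_loop_weight; rewrite -subr_gt0.
have -> : 2^-1 - a = x / 2 by rewrite xE; field.
by rewrite divr_gt0.
Qed.

Lemma Phi0E z : Phi (A0 u) z = x * z / (1 - a * z).
Proof. by rewrite /Phi /A0 /mx22 !mxE /= addr0 mulNr addrC. Qed.

Lemma Phi1E z : Phi (A1 u) z = x / (1 - a - a * z).
Proof. by rewrite /Phi /A1 /mx22 !mxE /= mul0r add0r mulNr addrC. Qed.

Lemma den0_gt0 z : 0 <= z <= 1 -> 0 < 1 - a * z.
Proof. by move=> zP; have := loop_weight_ge0; have := loop_weight_lt; nra. Qed.

Lemma den1_gt0 z : 0 <= z <= 1 -> 0 < 1 - a - a * z.
Proof. by move=> zP; have := loop_weight_ge0; have := loop_weight_lt; nra. Qed.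

(** The iterates of the functional equation, started from the distribution function
    of the point mass at 0. *)
Fixpoint finite_cdf (n : nat) (y : R) : R :=
  if n is n'.+1 then
    if y < 0 then 0
    else if y < 2^-1 then Phi (A0 u) (finite_cdf n' (2 * y))
    else if y < 1 then Phi (A1 u) (finite_cdf n' (2 * y - 1))
    else 1
  else (0 <= y)%R%:R.

Lemma Phi0_itv z : 0 <= z <= 1 -> 0 <= Phi (A0 u) z <= 1.
Proof.
move=> zP; rewrite Phi0E; have d := den0_gt0 zP; case/andP: zP => z0 z1.
have h := x_loop_weight; have := loop_weight_ge0; have := ltW (x_gt0 u) => h1 h2.
rewrite divr_ge0 ?(ltW d) ?mulr_ge0 //= ler_pdivrMr // mul1r h.
have := mulr_ge0 h2 z0; have : 0 <= (1 - a) * (1 - z).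
  by rewrite mulr_ge0; have := loop_weight_lt; lra.
lra.
Qed.

Lemma Phi1_itv z : 0 <= z <= 1 -> 0 <= Phi (A1 u) z <= 1.
Proof.
move=> zP; rewrite Phi1E; have d := den1_gt0 zP; case/andP: zP => z0 z1.
have h := x_loop_weight; have := loop_weight_ge0; have := ltW (x_gt0 u) => h1 h2.
rewrite divr_ge0 ?(ltW d) //= ler_pdivrMr // mul1r h.
have : 0 <= a * (1 - z) by rewrite mulr_ge0 // subr_ge0.
lra.
Qed.

Lemma finite_cdf_itv n y : 0 <= finite_cdf n y <= 1.
Proof.
elim: n y => [|n IH] y /=; first by rewrite ler0n lern1 leq_b1.
case: ifP => _; first by rewrite lexx ler01.
case: ifP => _; first exact: Phi0_itv.
by case: ifP => _; [exact: Phi1_itv|rewrite lexx ler01].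
Qed.

Lemma finite_cdf_ge1 n y : 1 <= y -> finite_cdf n y = 1.
Proof.
move=> y1; case: n => [|n] /=; first by rewrite (le_trans ler01 y1).
by rewrite !ifF //; apply/negbTE; rewrite -leNgt; lra.
Qed.

Lemma finite_cdf_lt0 n y : y < 0 -> finite_cdf n y = 0.
Proof. by case: n => [|n] /= y0; [rewrite leNgt y0|rewrite y0]. Qed.

Lemma finite_cdf_dyadic n y k : k%:R <= 2 ^+ n * y < k%:R + 1 ->
  finite_cdf n y = finite_cdf n (k%:R / 2 ^+ n).
Proof.
elim: n y k => [|n IH] y k.
  rewrite expr0 mul1r invr1 mulr1 /= => /andP[ky _].
  by rewrite ler0n (le_trans _ ky).
have p0 : 0 < 2 ^+ n :> R by rewrite exprn_gt0.
rewrite exprS => kP /=.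
have y0 : 0 <= y.
  by rewrite -(pmulr_rge0 _ (_ : 0 < 2 * 2 ^+ n)) ?mulr_gt0 //; have := ler0n R k; lra.
have kE : k%:R / (2 * 2 ^+ n) * (2 * 2 ^+ n) = k%:R :> R by rewrite mulfVK //; lra.
have k0 := ler0n R k.
have q0 : 0 <= k%:R / (2 * 2 ^+ n) :> R by rewrite divr_ge0 // mulr_ge0 // ltW.
rewrite [y < 0]ltNge y0 [_ / _ < 0]ltNge q0 /=.
have p2 : (2 ^ n)%N%:R = 2 ^+ n :> R by rewrite natrX.
have [yh|yh] := ltP y 2^-1.
  have kn : (k < 2 ^ n)%N by rewrite -(ltr_nat R) p2; nra.
  have kn' : k%:R + 1 <= 2 ^+ n :> R by rewrite -p2 natr1 ler_nat.
  rewrite ifT; last by nra.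
  congr Phi; rewrite (IH (2 * y) k); last by lra.
  by congr (finite_cdf n _); field; lra.
have kn : (2 ^ n <= k)%N by rewrite -ltnS -(ltr_nat R) p2 -natr1; nra.
have kn' : 2 ^+ n <= k%:R :> R by rewrite -p2 ler_nat.
rewrite (_ : (k%:R / (2 * 2 ^+ n) < 2^-1) = false); last by apply/negbTE; rewrite -leNgt; nra.
have [y1|y1] := ltP y 1.
  have kn2 : (k < 2 * 2 ^ n)%N by rewrite -(ltr_nat R) natrM p2; nra.
  have kn2' : k%:R + 1 <= 2 * 2 ^+ n :> R by rewrite -p2 natr1 -natrM ler_nat.
  rewrite ifT; last by nra.
  congr Phi; rewrite (IH (2 * y - 1) (k - 2 ^ n)%N) natrB // p2; last by lra.
  by congr (finite_cdf n _); field; lra.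
have kn2 : (2 * 2 ^ n <= k)%N by rewrite -ltnS -(ltr_nat R) natrM p2 -natr1; nra.
have kn2' : 2 * 2 ^+ n <= k%:R :> R by rewrite -p2 -natrM ler_nat.
by rewrite ifF //; apply/negbTE; rewrite -leNgt; nra.
Qed.

End Constants.

(** * The law of the scaled range *)

Section Law.
Context {R : realType}.
Variable u : R.
Hypothesis u0 : 0 <= u.
Variable P : probability Winfty R.
Hypothesis hP : is_Pu u P.
Local Notation x := (x_ u).
Local Notation fn := (finite_cdf u).

Lemma esum_cylinder_le n (D : set (seq int)) (B : set Winfty) :
  (forall w, D w -> exists2 e, (e == 1) || (e == -1) & exits n e w) ->
  measurable B -> (forall w, D w -> cylinder w `<=` B) ->
  (\esum_(w in D) P (cylinder w) <= P B)%E.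
Proof.
move=> De mB DB; apply: ge_ereal_sup => _ [X [finX XD] <-].
have mX w : X w -> measurable (cylinder w).
  by move=> /XD/De[e _ [Ww _ _ _]]; exact: measurable_cylinder.
have tX : trivIset X cylinder.
  move=> w w' /XD/De[e e1 wP] /XD/De[e' e1' wP'] [om [c c']].
  exact: cylinder_disj e1 e1' wP wP' c c'.
rewrite -measure_fsbig // fsbig_setU //; apply: le_measure; rewrite ?inE //.
- exact: fin_bigcup_measurable.
- by apply: bigcup_sub => w /XD/DB.
Qed.

(** The factors 1/2 in front of the masses of a word and of its mirror image add up
    to 1. *)
Lemma word_mass_le n (D : set (seq int)) (B : set Winfty) :
  D `<=` exit_word n.+1 -> measurable B ->
  (forall w, D w -> cylinder w `<=` B /\ cylinder (opp_path w) `<=` B) ->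
  (word_mass u n.+1 D <= P B)%E.
Proof.
move=> DV mB DB.
have [hp hm] : (forall w, D w -> P (cylinder w) = (2^-1 * Pplus u n.+1 w)%:E) /\
    (forall w, D w -> P (cylinder (opp_path w)) = (2^-1 * Pplus u n.+1 w)%:E).
  have [h1 h2] := hP (ltn0Sn n); split=> w /DV Vw; first exact/h1/exit_word_Wplus.
  by rewrite h2 ?exit_word_Wminus // /Pminus -/(opp_path _) opp_pathK.
have -> : word_mass u n.+1 D =
    (\esum_(w in D `|` opp_path @` D) P (cylinder w))%E.
  rewrite esum_setU //.
    rewrite (esum_image D opp_path (fun w => P (cylinder w))); last first.
      by move=> w w' _ _; exact: (inv_inj opp_pathK).
    rewrite (eq_esum (b := fun w => (2^-1)%:E * (word_weight u n.+1 w)%:E)%E); last first.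
      by move=> w Dw; rewrite hp // EFinM.
    rewrite [X in (_ + X)%E](eq_esum
        (b := fun w => (2^-1)%:E * (word_weight u n.+1 w)%:E)%E); last first.
      by move=> w Dw; rewrite hm // EFinM.
    have wf w : (0 <= (word_weight u n.+1 w)%:E)%E by rewrite lee_fin word_weight_ge0.
    rewrite esumZl // -ge0_muleDl ?lee_fin //.
    by rewrite -EFinD (_ : 2^-1 + 2^-1 = 1 :> R) ?mul1e //; field.
  apply/disj_setPS => w [Dw [w' Dw' ww']].
  have := exits_sign_neq (exit_word_exits (DV _ Dw)) (exit_word_exits_opp (DV _ Dw')).
  by rewrite ww'; apply.
apply: (@esum_cylinder_le n.+1) => //.
  move=> w [/DV/exit_word_exits h|[w' /DV/exit_word_exits_opp h <-]].
    by exists 1.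
  by exists (-1).
by move=> w [/DB[]//|[w' /DB[_ h] <-]].
Qed.

(** Disjoint cylinders bound the mass by that of the whole space. *)
Lemma word_mass_fin n D : D `<=` exit_word n.+1 ->
  exists2 s : R, word_mass u n.+1 D = s%:E & 0 <= s.
Proof.
move=> DV.
have le1 : (word_mass u n.+1 D <= 1)%E.
  by rewrite -(@probability_setT _ _ _ P); exact: word_mass_le.
have ge0 : (0 <= word_mass u n.+1 D)%E.
  by apply: esum_ge0 => w _; rewrite lee_fin word_weight_ge0.
exists (fine (word_mass u n.+1 D)); last exact: fine_ge0.
by rewrite fineK // ge0_fin_numE // (le_lt_trans le1) // ltry.
Qed.

Lemma exit_word0E : exit_word 0 = [set [:: 0; 1]].
Proof.
apply/seteqP; split=> w /=; last by move=> ->; exact: exit_word_unit.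
by move=> h; inversion h.
Qed.

(** The decomposition of the words above [- k] is the recursion that defines
    [finite_cdf], once the geometric series over the loops is summed. *)
Lemma word_mass_above n k : word_mass u n (words_above n k) = (fn n (k%:R / 2 ^+ n))%:E.
Proof.
elim: n k => [|n IH] k.
  rewrite words_above_top // exit_word0E /word_mass esum_set1 /= ?lee_fin ?ler01 //.
  by rewrite expr0 invr1 mulr1 ler0n.
have EV : word_mass u n (exit_word n) = 1%:E.
  rewrite -(@words_above_top n (2 ^ n)) // IH finite_cdf_ge1 // natrX divff // expf_neq0 //.
have [s Es s0] := word_mass_fin (@words_above_sub n.+1 k); rewrite Es; congr EFin.
have p0 : 0 < 2 ^+ n :> R by rewrite exprn_gt0.
have p2 : (2 ^ n)%N%:R = 2 ^+ n :> R by rewrite natrX.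
have k0 := ler0n R k.
have hk : 2 * (k%:R / 2 ^+ n.+1) = k%:R / 2 ^+ n :> R.
  by rewrite exprS; field; rewrite gt_eqF.
have q0 : 0 <= k%:R / 2 ^+ n.+1 :> R by rewrite divr_ge0 // exprn_ge0.
rewrite /= ltNge q0 /= -/(2^-1).
have [kn|kn] := ltnP k (2 ^ n).
  have yh : k%:R / 2 ^+ n < 1 :> R by rewrite ltr_pdivrMr // mul1r -p2 ltr_nat.
  rewrite ifT; last by rewrite -hk in yh; lra.
  rewrite hk Phi0E; set g := finite_cdf _ _ _.
  have gi : 0 <= g <= 1 by exact: finite_cdf_itv.
  have := den0_gt0 u gi => d.
  have := word_mass_lo u0 kn (IH k) EV Es; rewrite -/(loop_weight u) -/g => sE.
  by apply: (mulIf (lt0r_neq0 d)); rewrite mulfVK ?lt0r_neq0 //; lra.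
have yh : 1 <= k%:R / 2 ^+ n :> R by rewrite ler_pdivlMr // mul1r -p2 ler_nat.
rewrite ifF; last by apply/negbTE; rewrite -hk in yh; rewrite -leNgt; lra.
have := word_mass_hi u0 kn (IH _) EV Es; rewrite -/(loop_weight u) natrB // p2.
have -> : (k%:R - 2 ^+ n) / 2 ^+ n = k%:R / 2 ^+ n - 1 :> R.
  by rewrite mulrBl divff // gt_eqF.
rewrite -hk; have [y1|y1] := ltP (k%:R / 2 ^+ n.+1 : R) 1.
  rewrite Phi1E; set g := finite_cdf _ _ _ => sE.
  have gi : 0 <= g <= 1 by exact: finite_cdf_itv.
  have := den1_gt0 u gi => d.
  by apply: (mulIf (lt0r_neq0 d)); rewrite mulfVK ?lt0r_neq0 //; lra.
rewrite finite_cdf_ge1; last by lra.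
move=> sE; have x0 := x_gt0 u; have xE := x_loop_weight u.
apply: (mulfI (lt0r_neq0 x0)); rewrite mulr1; move: sE.
by rewrite -/(loop_weight u) {2 3}xE; lra.
Qed.

Lemma word_mass_all n : word_mass u n (exit_word n) = 1%E.
Proof.
rewrite -(@words_above_top n (2 ^ n)) // word_mass_above finite_cdf_ge1 //.
by rewrite natrX divff // expf_neq0.
Qed.

Lemma word_mass_below n k :
  word_mass u n (exit_word n `&` ~` words_above n k) = (1 - fn n (k%:R / 2 ^+ n))%:E.
Proof.
have wf w : (0 <= (word_weight u n w)%:E)%E by rewrite lee_fin word_weight_ge0.
have := esumID (words_above n k) (exit_word n) 
  (fun w => (word_weight u n w)%:E) (fun w _ => wf w).
rewrite -!/(word_mass u n _) word_mass_all (setIidr (@words_above_sub n k)).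
rewrite word_mass_above EFinB => ->.
by rewrite addeAC subee ?add0e.
Qed.

Local Notation X n := (@scaled_range R n).

Lemma scaled_range_le n (m : nat) om :
  (X n om <= m%:R / 2 ^+ n) = (Rn n om <= 2 ^ n + m)%N.
Proof.
have p0 : 0 < 2 ^+ n :> R by rewrite exprn_gt0.
rewrite /scaled_range lerBlDr ler_pdivrMr // mulrDl mulfVK ?gt_eqF // mul1r.
by rewrite -natrX -natrD ler_nat addnC.
Qed.

Lemma measurable_le n (y : R) : measurable [set om | X n om <= y].
Proof.
have := @measurable_scaled_range R n measurableT `]-oo, y]%classic.
rewrite setTI => /(_ (measurable_itv _)) /=.
by rewrite (_ : _ @^-1` _ = [set om | X n om <= y]) //; apply/seteqP; split=> om /=;
  rewrite in_itv.
Qed.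

Lemma Rn_exit_word n w k om : exit_word n w ->
  cylinder w om \/ cylinder (opp_path w) om ->
  (Rn n om <= 2 ^ n + k)%N = above k w.
Proof.
move=> Vw; wlog c : om / cylinder w om.
  move=> H [c|c]; first by apply: H => //; left.
  by rewrite -Rn_reflect; apply: H; [|left]; exact: cylinder_reflect.
move=> _; apply/idP/idP; last exact: Rn_le (exit_word_exits Vw) c.
by apply: contraTT => /(Rn_gt (exit_word_exits Vw) c); rewrite -ltnNge.
Qed.

(** The masses of the words above [- k] and of the other ones bound the probabilities
    of two complementary events from below; as they add up to 1, both bounds are
    equalities. *)
Lemma scaled_range_cdf_dyadic n k :
  P [set om | X n.+1 om <= k%:R / 2 ^+ n.+1] = (fn n.+1 (k%:R / 2 ^+ n.+1))%:E.
Proof.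
set B := [set _ | _]; have mB : measurable B by exact: measurable_le.
have PB : P B \is a fin_num by exact: fin_num_measure.
apply/eqP; rewrite eq_le -word_mass_above; apply/andP; split; last first.
  apply: word_mass_le => //; first exact: words_above_sub.
  by move=> w [Vw aw]; split=> om c; rewrite /B /= scaled_range_le;
    rewrite (Rn_exit_word _ Vw) //; [left|right].
have : (word_mass u n.+1 (exit_word n.+1 `&` ~` words_above n.+1 k) <= P (~` B))%E.
  apply: word_mass_le; [exact: subIsetl|exact: measurableC|].
  move=> w [Vw Aw]; split=> om c; rewrite /B /= scaled_range_le;
    rewrite (Rn_exit_word _ Vw) //;
    [move=> aw; exact: Aw|by left|move=> aw; exact: Aw|by right].
rewrite probability_setC // word_mass_below word_mass_above -(fineK PB) -EFinB !lee_fin; lra.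
Qed.

Lemma scaled_range_cdf n y : P [set om | X n.+1 om <= y] = (fn n.+1 y)%:E.
Proof.
have p0 : 0 < 2 ^+ n.+1 :> R by rewrite exprn_gt0.
have [y0|y0] := ltP y 0.
  rewrite finite_cdf_lt0 //; apply/eqP; rewrite eq_le measure_ge0 andbT.
  set B := [set _ | _]; have mB : measurable B by exact: measurable_le.
  have PB : P B \is a fin_num by exact: fin_num_measure.
  have : (word_mass u n.+1 (exit_word n.+1) <= P (~` B))%E.
    apply: word_mass_le => //; first exact: measurableC.
    have key w om : exit_word n.+1 w -> cylinder w om -> ~ B om.
      move=> Vw c; rewrite /B /=; apply/negP; rewrite -ltNge (lt_le_trans y0) //.
      have := @Rn_ge n.+1 w om 0 0 (exit_word_exits Vw) c (leq0n _).
      rewrite (Wstar_nth0 (exit_word_Wstar Vw)) => /(_ isT).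
      rewrite addn0 /scaled_range subr_ge0 ler_pdivlMr // mul1r -natrX ler_nat.
      by [].
    move=> w Vw; split=> om c; first exact: key Vw c.
    have := key _ _ Vw (cylinder_reflect c).
    by rewrite /B /= /scaled_range Rn_reflect.
  by rewrite probability_setC // word_mass_all -(fineK PB) -EFinB !lee_fin; lra.
pose k := Num.truncn (2 ^+ n.+1 * y).
have kP : k%:R <= 2 ^+ n.+1 * y < k%:R + 1.
  rewrite natr1; apply: truncn_itv; rewrite mulr_ge0 // ltW //.
rewrite (finite_cdf_dyadic _ kP) -scaled_range_cdf_dyadic; congr (P _).
apply/seteqP; split=> om /=.
  rewrite scaled_range_le /scaled_range lerBlDr ler_pdivrMr // => h.
  rewrite -ltnS -(ltr_nat R) -natr1 natrD natrX; case/andP: kP => _; lra.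
by move=> /le_trans; apply; rewrite ler_pdivrMr // mulrC; case/andP: kP.
Qed.

End Law.

(** * The limit distribution function *)

(** The half-open intervals are a pi-system generating the Borel sets. *)
Lemma cdf_unique (R : realType) (m1 m2 : {measure set R -> \bar R}) :
  (forall y, m1 `]-oo, y]%classic = m2 `]-oo, y]%classic) ->
  (m1 setT < +oo)%E ->
  forall A : set R, measurable A -> m1 A = m2 A.
Proof.
move=> m12 m1fin.
have le_fin (m : {measure set R -> \bar R}) y : (m setT < +oo)%E ->
    (m `]-oo, y]%classic < +oo)%E.
  by move=> mT; apply: le_lt_trans mT; apply: le_measure; rewrite ?inE.
apply: (@measure_unique _ _ _ (@ocitv R)
  (fun n => `](- n%:R), n%:R]%classic)) => //.
- by move=> A B; exact: ocitvI.
- by move=> i; exact: is_ocitv.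
- exact: (bigcup_itvT false false).
- move=> _ [[a b] _ <-] /=.
  have [ab|ba] := leP a b; last first.
    by rewrite set_itv_ge ?measure0 // bnd_simp -leNgt ltW.
  have -> : `]a, b]%classic = `]-oo, b]%classic `\` `]-oo, a]%classic.
    by apply/seteqP; split=> z /=; rewrite !in_itv /= ltNge;
      [move=> /andP[/negP ? ->]|move=> [-> /negP ->]].
  have iE : `]-oo, b]%classic `&` `]-oo, a]%classic = `]-oo, a]%classic :> set R.
    by apply: setIidr; exact: subset_itvl.
  have m2fin : (m2 `]-oo, b]%classic < +oo)%E by rewrite -m12; exact: le_fin.
  have m1fin' := le_fin m1 b m1fin.
  by rewrite !measureD // ?iE; congr (_ - _)%E; exact: m12.
- by move=> k; apply: le_lt_trans m1fin; apply: le_measure; rewrite ?inE.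
Qed.

Lemma lebesgue_stieltjes_oc (R : realType) (F : cumulative R R) (a b : R) :
  a <= b -> lebesgue_stieltjes_measure F `]a, b]%classic = (F b - F a)%:E.
Proof.
move=> ab; rewrite /lebesgue_stieltjes_measure /measure_extension.
by rewrite measurable_mu_extE /= ?wlength_itv_bnd //; exact: is_ocitv.
Qed.

Section Limit.
Context {R : realType}.
Variable u : R.
Local Notation x := (x_ u).
Local Notation a := (loop_weight u).
Local Notation fn := (finite_cdf u).

Lemma Phi0_le y z : 0 <= y -> y <= z -> z <= 1 -> Phi (A0 u) y <= Phi (A0 u) z.
Proof.
move=> y0 yz z1.
have dy : 0 < 1 - a * y by apply: den0_gt0; lra.
have dz : 0 < 1 - a * z by apply: den0_gt0; lra.
rewrite !Phi0E ler_pdivlMr // mulrAC ler_pdivrMr //.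
have := mulr_ge0 (ltW (x_gt0 u)) (_ : 0 <= z - y); rewrite subr_ge0 => /(_ yz); lra.
Qed.

Lemma Phi1_le y z : 0 <= y -> y <= z -> z <= 1 -> Phi (A1 u) y <= Phi (A1 u) z.
Proof.
move=> y0 yz z1.
have dy : 0 < 1 - a - a * y by apply: den1_gt0; lra.
have dz : 0 < 1 - a - a * z by apply: den1_gt0; lra.
rewrite !Phi1E ler_pM2l ?x_gt0 // lef_pV2 ?posrE // lerB // ler_wpM2l //.
exact: loop_weight_ge0.
Qed.

Lemma Phi1_0 : Phi (A1 u) 0 = Phi (A0 u) 1.
Proof. by rewrite Phi0E Phi1E !mulr1 mulr0 subr0. Qed.
Lemma Phi1_1 : Phi (A1 u) 1 = 1.
Proof.
rewrite Phi1E mulr1 [in X in X / _]x_loop_weight (_ : 1 - a - a = 1 - 2 * a); last by ring.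
by rewrite divff // -x_loop_weight gt_eqF // x_gt0.
Qed.

Lemma finite_cdf_ge0 n y : 0 <= fn n y. Proof. by have /andP[] := finite_cdf_itv u n y. Qed.
Lemma finite_cdf_le1 n y : fn n y <= 1. Proof. by have /andP[] := finite_cdf_itv u n y. Qed.

Lemma finite_cdf_decr n y : fn n.+1 y <= fn n y.
Proof.
elim: n y => [|n IH] y.
  have [y0|y0] := ltP y 0; first by rewrite !finite_cdf_lt0.
  by rewrite [leRHS]/= y0 finite_cdf_le1.
have step m : finite_cdf u m.+1 y = if y < 0 then 0
    else if y < 2^-1 then Phi (A0 u) (fn m (2 * y))
    else if y < 1 then Phi (A1 u) (fn m (2 * y - 1)) else 1 by [].
rewrite !step; case: ifP => // _; case: ifP => _.
  by rewrite Phi0_le ?finite_cdf_ge0 ?finite_cdf_le1.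
by case: ifP => // _; rewrite Phi1_le ?finite_cdf_ge0 ?finite_cdf_le1.
Qed.

(** The two branches match at 1/2 by [Phi1_0]. *)
Lemma finite_cdf_mono n y z : y <= z -> fn n y <= fn n z.
Proof.
elim: n y z => [|n IH] y z yz.
  by rewrite /= ler_nat; case: (leP 0 y) => // y0; rewrite (le_trans y0 yz).
have [y0|y0] := ltP y 0; first by rewrite finite_cdf_lt0 // finite_cdf_ge0.
have z0 : 0 <= z by lra.
have [z1|z1] := leP 1 z; first by rewrite [leRHS]finite_cdf_ge1 // finite_cdf_le1.
have y1 : y < 1 by lra.
rewrite /= !ltNge y0 z0 /= -!ltNge y1 z1.
have [yh|yh] := ltP y 2^-1; have [zh|zh] := ltP z 2^-1.
- by rewrite Phi0_le ?finite_cdf_ge0 ?finite_cdf_le1 // IH //; lra.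
- apply: (@le_trans _ _ (Phi (A0 u) 1)); first
    by rewrite Phi0_le ?finite_cdf_ge0 ?finite_cdf_le1.
  by rewrite -Phi1_0 Phi1_le ?finite_cdf_ge0 ?finite_cdf_le1.
- lra.
- by rewrite Phi1_le ?finite_cdf_ge0 ?finite_cdf_le1 // IH //; lra.
Qed.

(** The infimum is the pointwise limit; as an infimum of right-continuous monotone
    functions it is right-continuous. *)
Definition limit_cdf (y : R) : R := inf (range (fn ^~ y)).
Local Notation f := limit_cdf.

Lemma finite_cdf_cvg y : fn n y @[n --> \oo] --> f y.
Proof.
apply: nonincreasing_cvgn; first by apply/nonincreasing_seqP => n; exact: finite_cdf_decr.
by exists 0 => _ [n _ <-]; exact: finite_cdf_ge0.
Qed.

Lemma limit_cdf_le n y : f y <= fn n y.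
Proof.
apply: ge_inf; last by exists n.
by exists 0 => _ [m _ <-]; exact: finite_cdf_ge0.
Qed.

Lemma limit_cdf_ge0 y : 0 <= f y.
Proof.
apply: lb_le_inf; first by exists (fn 0 y); exists 0%N.
by move=> _ [n _ <-]; exact: finite_cdf_ge0.
Qed.

Lemma limit_cdf_le1 y : f y <= 1.
Proof. exact: le_trans (limit_cdf_le 0 y) (finite_cdf_le1 _ _). Qed.

Lemma limit_cdf_lt0 y : y < 0 -> f y = 0.
Proof.
move=> y0; apply/eqP; rewrite eq_le limit_cdf_ge0 andbT.
by rewrite (le_trans (limit_cdf_le 0 y)) // finite_cdf_lt0.
Qed.

Lemma limit_cdf_ge1 y : 1 <= y -> f y = 1.
Proof.
move=> y1; have h : fn n y @[n --> \oo] --> (1 : R).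
  by under eq_fun do rewrite finite_cdf_ge1 //; exact: cvg_cst.
exact: (cvg_unique _ (@finite_cdf_cvg y) h).
Qed.

Lemma limit_cdf_nd : nondecreasing f.
Proof.
move=> y z yz; apply: (ler_cvg_to (@finite_cdf_cvg y) (@finite_cdf_cvg z)).
by apply: nearW => n; exact: finite_cdf_mono.
Qed.

(** Near [y] on the right, [finite_cdf u n] is constant, and for [n] large its value
    at [y] is close to the limit. *)
Lemma limit_cdf_rc : right_continuous f.
Proof.
move=> y; apply/cvgrPdist_le => /= e e0.
have /cvgrPdist_lt /(_ _ e0) [n _ /(_ n (leqnn _)) /= fe] := @finite_cdf_cvg y.
have p0 : 0 < 2 ^+ n :> R by rewrite exprn_gt0.
have [z yz zP] : exists2 z, y < z & forall w, y <= w -> w < z -> fn n w = fn n y.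
  have [y0|y0] := ltP y 0.
    by exists 0 => // w yw w0; rewrite !finite_cdf_lt0.
  pose k := Num.truncn (2 ^+ n * y).
  have kP : k%:R <= 2 ^+ n * y < k%:R + 1.
    by rewrite natr1; apply: truncn_itv; rewrite mulr_ge0 // ltW.
  exists ((k%:R + 1) / 2 ^+ n).
    by rewrite ltr_pdivlMr // mulrC; case/andP: kP.
  move=> w yw wz; rewrite (finite_cdf_dyadic _ kP); apply: finite_cdf_dyadic.
  rewrite ltr_pdivlMr // mulrC in wz; rewrite wz andbT.
  by case/andP: kP => /le_trans -> //; rewrite ler_pM2l.
near=> w.
have yw : y < w by near: w; exact: nbhs_right_gt.
have wz : w < z by near: w; exact: nbhs_right_lt.
have := limit_cdf_le n w; rewrite (zP _ (ltW yw) wz) => fw.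
have := limit_cdf_nd (ltW yw) => fyw.
rewrite distrC ger0_norm ?subr_ge0 //.
have := limit_cdf_le n y => fy; move: fe; rewrite distrC ger0_norm ?subr_ge0 //; lra.
Unshelve. all: end_near. Qed.

HB.instance Definition _ := isCumulative.Build R _ R f limit_cdf_nd limit_cdf_rc.

Lemma limit_cdf_Ny : f @ -oo --> (0 : R).
Proof.
apply: cvg_near_cst; near=> y; apply: limit_cdf_lt0; near: y.
by apply: nbhs_ninfty_lt; rewrite num_real.
Unshelve. all: end_near. Qed.

Lemma limit_cdf_y : f @ +oo --> (1 : R).
Proof.
apply: cvg_near_cst; near=> y; apply: limit_cdf_ge1; near: y.
by apply: nbhs_pinfty_ge; rewrite num_real.
Unshelve. all: end_near. Qed.

HB.instance Definition _ := isCumulativeBounded.Build R 0 1 f limit_cdf_Ny limit_cdf_y.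

Lemma limit_cdf_lo_lt y : 0 <= y < 2^-1 -> f y = Phi (A0 u) (f (2 * y)).
Proof.
move=> /andP[y0 yh].
have h : fn n.+1 y @[n --> \oo] --> f y by have := @finite_cdf_cvg y; rewrite -cvg_shiftS.
suff h' : fn n.+1 y @[n --> \oo] --> Phi (A0 u) (f (2 * y)).
  exact: (cvg_unique _ h h').
under eq_fun do rewrite /= ltNge y0 /= yh Phi0E.
rewrite Phi0E; have d : 1 - a * f (2 * y) != 0.
  by rewrite gt_eqF // den0_gt0 // limit_cdf_ge0 limit_cdf_le1.
apply: cvgM; first by apply: cvgMr; exact: finite_cdf_cvg.
apply: cvgV => //; apply: cvgB; first exact: cvg_cst.
by apply: cvgMr; exact: finite_cdf_cvg.
Qed.

Lemma limit_cdf_hi_lt y : 2^-1 <= y < 1 -> f y = Phi (A1 u) (f (2 * y - 1)).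
Proof.
move=> /andP[yh y1]; have y0 : 0 <= y by lra.
have h : fn n.+1 y @[n --> \oo] --> f y by have := @finite_cdf_cvg y; rewrite -cvg_shiftS.
suff h' : fn n.+1 y @[n --> \oo] --> Phi (A1 u) (f (2 * y - 1)).
  exact: (cvg_unique _ h h').
under eq_fun do rewrite /= ltNge y0 /= ltNge yh /= y1 Phi1E.
rewrite Phi1E; have d : 1 - a - a * f (2 * y - 1) != 0.
  by rewrite gt_eqF // den1_gt0 // limit_cdf_ge0 limit_cdf_le1.
apply: cvgMr.
apply: cvgV => //; apply: cvgB; first exact: cvg_cst.
by apply: cvgMr; exact: finite_cdf_cvg.
Qed.

Lemma limit_cdf_hi y : 2^-1 <= y <= 1 -> f y = Phi (A1 u) (f (2 * y - 1)).
Proof.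
move=> /andP[yh y1]; have [{}y1|{}y1] := ltP y 1; first by apply: limit_cdf_hi_lt; rewrite yh.
by rewrite !limit_cdf_ge1 ?Phi1_1 //; lra.
Qed.

(** The only fixed points of [Phi (A0 u)] are 0 and 2, unless the map is the identity. *)
Lemma limit_cdf0 : f 0 = 0 \/ a = 0.
Proof.
have : f 0 = Phi (A0 u) (f 0).
  by rewrite [LHS]limit_cdf_lo_lt ?mulr0 // lexx invr_gt0 ltr0n.
have h0 := limit_cdf_ge0 0; have h1 := limit_cdf_le1 0; rewrite Phi0E.
have d : 0 < 1 - a * f 0 by rewrite den0_gt0 // h0.
move=> E; have {}E : f 0 * (1 - a * f 0) = x * f 0.
  by rewrite {1}E mulfVK // gt_eqF.
case: (eqVneq (f 0) 0) => [|fn0]; first by left.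
right; have : 1 - a * f 0 = x by apply: (mulIf fn0); rewrite mulrC.
by rewrite x_loop_weight; have := loop_weight_ge0 u; nra.
Qed.

(** The endpoint 1/2 belongs to both branches: [f 0] is 0, or [Phi (A1 u)] is
    constant. *)
Lemma limit_cdf_lo y : 0 <= y <= 2^-1 -> f y = Phi (A0 u) (f (2 * y)).
Proof.
move=> /andP[y0]; rewrite le_eqVlt => /orP[/eqP ->|yh]; last first.
  by apply: limit_cdf_lo_lt; rewrite y0.
rewrite divff ?pnatr_eq0 // (limit_cdf_ge1 (lexx _)) limit_cdf_hi ?lexx /=; last by lra.
rewrite divff ?pnatr_eq0 // subrr -Phi1_0.
by case: limit_cdf0 => [->//|a0]; rewrite !Phi1E a0 !mul0r.
Qed.

(** The value of the limit at a grid point is reached after [n] steps on the dyadic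
    interval to its left: the jumps of [finite_cdf u n] are at the left ends. *)
Lemma limit_cdf_dyadic n k : f (k.+1%:R / 2 ^+ n) = fn n (k%:R / 2 ^+ n).
Proof.
elim: n k => [|n IH] k.
  by rewrite expr0 invr1 !mulr1 /= ler0n limit_cdf_ge1 // ler1n.
have p0 : 0 < 2 ^+ n :> R by rewrite exprn_gt0.
have p2 : (2 ^ n)%N%:R = 2 ^+ n :> R by rewrite natrX.
have hk (l : R) : 2 * (l / 2 ^+ n.+1) = l / 2 ^+ n.
  by rewrite exprS; field; rewrite gt_eqF.
have k0 := ler0n R k.
have q0 (l : nat) : 0 <= l%:R / 2 ^+ n.+1 :> R by rewrite divr_ge0 // exprn_ge0.
have [kn|kn] := ltnP k (2 ^ n).
  have h1 : k.+1%:R / 2 ^+ n <= 1 :> R by rewrite ler_pdivrMr // mul1r -p2 ler_nat.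
  have h2 : k%:R / 2 ^+ n < 1 :> R by rewrite ltr_pdivrMr // mul1r -p2 ltr_nat.
  rewrite limit_cdf_lo; last by rewrite q0 /=; move: h1; rewrite -hk; lra.
  rewrite /= ltNge q0 /= ifT; last by move: h2; rewrite -hk; lra.
  by rewrite !hk IH.
have h2 : 1 <= k%:R / 2 ^+ n :> R by rewrite ler_pdivlMr // mul1r -p2 ler_nat.
have hs : k%:R / 2 ^+ n < k.+1%:R / 2 ^+ n :> R.
  by rewrite ltr_pM2r ?invr_gt0 // ltr_nat.
have [kn2|kn2] := ltnP k (2 ^ n.+1); last first.
  have : 1 <= k%:R / 2 ^+ n.+1 :> R.
    by rewrite ler_pdivlMr ?exprn_gt0 // mul1r -natrX ler_nat.
  by move=> h; rewrite finite_cdf_ge1 // limit_cdf_ge1 //; move: h2 hs; rewrite -!hk; lra.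
have h1 : k.+1%:R / 2 ^+ n.+1 <= 1 :> R.
  by rewrite ler_pdivrMr ?exprn_gt0 // mul1r -natrX ler_nat.
have h3 : k%:R / 2 ^+ n.+1 < 1 :> R.
  by rewrite ltr_pdivrMr ?exprn_gt0 // mul1r -natrX ltr_nat.
rewrite limit_cdf_hi; last by rewrite h1 andbT; move: h2 hs; rewrite -!hk; lra.
rewrite /= ltNge q0 /= ifF; last by apply/negbTE; rewrite -leNgt; move: h2; rewrite -!hk; lra.
rewrite h3 !hk.
have e (l : nat) : (2 ^ n <= l)%N -> l%:R / 2 ^+ n - 1 = (l - 2 ^ n)%N%:R / 2 ^+ n :> R.
  by move=> ?; rewrite natrB // mulrBl p2 divff // gt_eqF.
by rewrite !e ?(leqW kn) // subSn // IH.
Qed.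

End Limit.

(** * The limit law and weak convergence *)

Section LimitLaw.
Context {R : realType}.
Variable u : R.
Local Notation f := (limit_cdf u).

Definition limit_law : probability (measurableTypeR R) R :=
  lebesgue_stieltjes_measure (limit_cdf u).
Local Notation mu := limit_law.

Lemma limit_law_cdf y : mu `]-oo, y]%classic = (f y)%:E.
Proof.
have := cdf_lebesgue_stieltjes_id (limit_cdf u) y.
by rewrite /cdf /distribution /pushforward preimage_id.
Qed.

Lemma limit_law_oc a b : a <= b -> mu `]a, b]%classic = (f b - f a)%:E.
Proof. exact: lebesgue_stieltjes_oc. Qed.

Lemma limit_law_neg : mu `]-oo, 0[%classic = 0%E.
Proof.
have -> : `]-oo, 0[%classic = \bigcup_n `]-oo, - n.+1%:R^-1 :> R]%classic.
  apply/seteqP; split=> z /=; rewrite in_itv /=.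
    move=> /ltr_add_invr [n zn]; exists n => //=; rewrite in_itv /=.
    by rewrite -subr_le0 opprK ltW.
  move=> [n _]; rewrite /= in_itv /= => /le_lt_trans; apply.
  by rewrite oppr_lt0 invr_gt0.
have mB n : measurable (`]-oo, - n.+1%:R^-1]%classic : set (measurableTypeR R)).
  exact: measurable_itv.
apply: measure_negligible; first exact: bigcupT_measurable.
apply: negligible_bigcup => n; exists `]-oo, - n.+1%:R^-1]%classic; split=> //.
by apply: etrans (limit_law_cdf _) _; rewrite limit_cdf_lt0 // oppr_lt0 invr_gt0.
Qed.

Lemma limit_law_itv01 : mu `[0, 1]%classic = 1%E.
Proof.
have -> : `[0, 1]%classic = `]-oo, 1]%classic `\` `]-oo, 0[%classic :> set R.
  by apply/seteqP; split=> z /=; rewrite !in_itv /= [0 <= z]leNgt;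
    [move=> /andP[/negP ? ->]|move=> [-> /negP ->]].
have iE : `]-oo, 1]%classic `&` `]-oo, 0[%classic = `]-oo, 0[%classic :> set R.
  by apply: setIidr => z /=; rewrite !in_itv /=; lra.
have bfin : (mu `]-oo, 1%R]%classic < +oo)%E by rewrite limit_law_cdf ltry.
rewrite measureD // ?iE; try exact: measurable_itv.
rewrite -[RHS]sube0; congr (_ - _)%E; last exact: limit_law_neg.
by apply: etrans (limit_law_cdf 1) _; rewrite limit_cdf_ge1.
Qed.

Lemma distribution_function_limit_law y : distribution_function mu y = f y.
Proof. by rewrite /distribution_function limit_law_cdf. Qed.

(** The left end of the dyadic interval, open on the left, that contains a positive
    [y].  Other points are left in place: they carry at most an atom at 0, and with
    this choice [round_down n] is close to the identity everywhere. *)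
Definition round_down (n : nat) (y : R) : R :=
  if y <= 0 then y else (Num.ceil (2 ^+ n * y) - 1)%:~R / 2 ^+ n.

Lemma round_down_le0 n y : y <= 0 -> round_down n y = y.
Proof. by rewrite /round_down => ->. Qed.

Lemma round_down_gt0 n y : 0 < y -> round_down n y = (Num.ceil (2 ^+ n * y) - 1)%:~R / 2 ^+ n.
Proof. by rewrite /round_down ltNge => /negbTE ->. Qed.

Lemma round_down_ge0 n y : 0 < y -> 0 <= round_down n y.
Proof.
move=> y0; rewrite round_down_gt0 // divr_ge0 ?exprn_ge0 // ler0z.
have : (0 < Num.ceil (2 ^+ n * y)) by rewrite ceil_gt0 mulr_gt0 ?exprn_gt0.
lia.
Qed.

Lemma round_down_nd n : nondecreasing (round_down n).
Proof.
move=> y z yz; have [y0|y0] := leP y 0.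
  rewrite (round_down_le0 _ y0); have [z0|z0] := leP z 0; first by rewrite round_down_le0.
  by rewrite (le_trans y0) // round_down_ge0.
have z0 : 0 < z by lra.
rewrite !round_down_gt0 // ler_pM2r ?invr_gt0 ?exprn_gt0 // ler_int lerD2r.
by apply: le_ceil; rewrite ler_pM2l ?exprn_gt0.
Qed.

Lemma round_down_dist n y : `|round_down n y - y| <= 2 ^- n.
Proof.
have p0 : 0 < 2 ^+ n :> R by rewrite exprn_gt0.
rewrite /round_down; case: ifP => _; first by rewrite subrr normr0 invr_ge0 ltW.
have /andP[c1 c2] := ceil_itv (2 ^+ n * y).
rewrite intrB in c1 *; set c := (_%:~R) in c1 c2 *.
have -> : (c - 1%:~R) / 2 ^+ n - y = - ((2 ^+ n * y - (c - 1)) / 2 ^+ n).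
  by field; rewrite gt_eqF.
rewrite normrN ger0_norm; last by rewrite divr_ge0 ?(ltW p0) //; lra.
by rewrite ler_pdivrMr // mulVf ?gt_eqF //; lra.
Qed.

Lemma measurable_round_down n : measurable_fun setT (round_down n).
Proof. by apply: nondecreasing_measurable => // y z; exact: round_down_nd. Qed.

(** The law of the scaled range is the limit law rounded down to the grid. *)
Lemma round_down_cdf n y : mu [set z | round_down n z <= y] = (finite_cdf u n y)%:E.
Proof.
have p0 : 0 < 2 ^+ n :> R by rewrite exprn_gt0.
have [y0|y0] := ltP y 0.
  rewrite finite_cdf_lt0 // -(limit_cdf_lt0 u y0) -limit_law_cdf; congr (mu _).
  apply/seteqP; split=> z /=; rewrite in_itv /=.
    by have [z0|/round_down_ge0 h] := leP z 0; [rewrite round_down_le0|have := h n; lra].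
  by move=> zy; rewrite round_down_le0 //; lra.
pose k := Num.truncn (2 ^+ n * y).
have kP : k%:R <= 2 ^+ n * y < k%:R + 1.
  by rewrite natr1; apply: truncn_itv; rewrite mulr_ge0 // ltW.
rewrite (finite_cdf_dyadic _ kP) -limit_cdf_dyadic -limit_law_cdf; congr (mu _).
apply/seteqP; split=> z /=; rewrite in_itv /= ler_pdivlMr // [z * _]mulrC.
  have [z0 _|z0] := leP z 0.
    by rewrite (@le_trans _ _ 0) // mulr_ge0_le0 // ltW.
  rewrite round_down_gt0 // ler_pdivrMr // [y * _]mulrC => h.
  have /andP[_ c2] := ceil_itv (2 ^+ n * z); apply: le_trans c2 _.
  rewrite -[k.+1%:R]/(k.+1%:~R) ler_int.
  have : (Num.ceil (2 ^+ n * z) - 1)%:~R < (k.+1%:Z)%:~R :> R.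
    by rewrite (le_lt_trans h) // -[ltRHS]natr1; case/andP: kP.
  by rewrite ltr_int; move: (Num.ceil _) => c; lia.
move=> h; have [z0|z0] := leP z 0; first by rewrite round_down_le0 //; exact: le_trans z0 y0.
rewrite round_down_gt0 // ler_pdivrMr // [y * _]mulrC.
apply: (@le_trans _ _ k%:R); last by case/andP: kP.
rewrite -[k%:R]/(k%:~R) ler_int.
have : Num.ceil (2 ^+ n * z) <= k.+1%:Z by rewrite ceil_le_int.
move: (Num.ceil _) => c; lia.
Qed.

End LimitLaw.

Section Weak.
Context {R : realType}.
Variable u : R.
Hypothesis u0 : 0 <= u.
Variable P : probability Winfty R.
Hypothesis hP : is_Pu u P.
Local Notation mu := (limit_law u).
Local Notation X n := (@scaled_range R n : {RV P >-> R}).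

Lemma limit_law_weak_cvg : weak_cvg (fun n => X n) mu.
Proof.
move=> g gc gb.
have mg : measurable_fun setT g by exact: continuous_measurable_fun.
have [M gM] : exists M, forall y, `|g y| <= M.
  have [M0 [_ h]] := gb.
  by exists (M0 + 1) => y; apply: (h (M0 + 1) _ y I); rewrite ltrDl.
have M0 : 0 <= M by apply: le_trans (gM 0).
have mgE : measurable_fun setT (EFin \o g) by exact/measurable_EFinP.
have gint d (T : measurableType d) (Q : probability T R) (Y : T -> R) :
    measurable_fun setT Y -> Q.-integrable setT (EFin \o (g \o Y)).
  move=> mY; apply: measurable_bounded_integrable => //.
  - by rewrite [ltLHS]probability_setT ltry.
  - exact: measurableT_comp.
  - by exists M; split=> [|M' MM' y _ /=]; [rewrite num_real|rewrite (le_trans (gM _)) // ltW].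
have step n : (\int[P]_om (g (X n.+1 om))%:E = \int[mu]_y (g (round_down n.+1 y))%:E)%E.
  have mr : measurable_fun setT (round_down n.+1 : measurableTypeR R -> R).
    exact: measurable_round_down.
  transitivity (\int[distribution P (X n.+1)]_y (g y)%:E)%E.
    rewrite integral_distribution //; apply: gint; exact: measurable_scaled_range.
  transitivity (\int[pushforward mu (round_down n.+1)]_y (g y)%:E)%E.
    apply: eq_measure_integral => A mA _; apply: cdf_unique => // [y|]; last first.
      by apply: le_lt_trans (probability_le1 _ _) _ => //; rewrite ltry.
    transitivity (finite_cdf u n.+1 y)%:E.
      rewrite -(scaled_range_cdf u0 hP); congr (P _).
    rewrite -round_down_cdf; congr (mu _).
  rewrite (integral_pushforward mr) // preimage_setT //; exact: gint.
rewrite -cvg_shiftS; under eq_fun do rewrite step.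
apply: (@dominated_cvg _ _ _ mu setT measurableT
  (fun n y => (g (round_down n.+1 y))%:E) (fun y => (g y)%:E) (fun=> M%:E)) => //.
- by move=> n; apply/measurable_EFinP; apply: measurableT_comp => //;
    exact: measurable_round_down.
- move=> y _; apply: cvg_EFin; first by near=> n.
  apply: (@cvg_comp _ _ _ (fun n => round_down n.+1 y) g _ (nbhs y)); last exact: gc.
  rewrite (@cvg_shiftS _ (fun n => round_down n y)).
  apply/cvgrPdist_le => e e0.
  have /cvgrPdist_le/(_ _ e0) : (2^-1 : R) ^+ n @[n --> \oo] --> 0.
    by apply: cvg_expr; rewrite ger0_norm ?invr_ge0 // invf_lt1 // ltr1n.
  apply: filterS => n; rewrite sub0r normrN => ne.
  rewrite distrC (le_trans (round_down_dist n y)) // -exprVn (le_trans _ ne) //.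
  exact: ler_norm.
- exact: finite_measure_integrable_cst.
- by move=> n y _; rewrite lee_fin.
Unshelve. all: end_near. Qed.

End Weak.

(** * Decay of the Hellinger affinity *)

Section Hellinger.
Context {R : realType}.
Variable u : R.
Local Notation x := (x_ u).
Local Notation a := (loop_weight u).
Local Notation f := (limit_cdf u).

(** The Moebius maps that fix 0 and 1. *)
Definition mobius (t z : R) : R := (1 + t) * z / (1 + t * z).
(** The common value of [Phi (A0 u)] at 1 and [Phi (A1 u)] at 0, that is, the value of
    the limit distribution function at 1/2. *)
Definition half_value : R := x / (1 - a).
(** The mass of [0, 1/2] for the distribution function [mobius t \o limit_cdf u]; the
    two maps that follow give the parameters of its restrictions to the two halves. *)
Definition left_mass (t : R) : R := mobius t half_value.
Definition left_param (t : R) : R := x * t - a.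
Definition right_param (t : R) : R := - a / (x * t + 1 - a).

Lemma half_value_itv : 0 < half_value <= 1.
Proof.
have a0 := loop_weight_ge0 u; have ah := loop_weight_lt u.
have x0 := x_gt0 u; have xE := x_loop_weight u.
have d : 0 < 1 - a by lra.
by rewrite /half_value divr_gt0 //= ler_pdivrMr //; lra.
Qed.

Lemma mobius_den_gt0 (t z : R) : -1 < t <= 0 -> 0 <= z <= 1 -> 0 < 1 + t * z.
Proof. by move=> tP zP; nra. Qed.

Lemma right_param_den t : -1 < t <= 0 -> a < x * t + 1 - a.
Proof.
move=> /andP[t1 t0]; have t2 : 0 < 1 + t by lra.
have := mulr_gt0 (x_gt0 u) t2; have xE := x_loop_weight u.
lra.
Qed.

(** Restricting to the left half and rescaling changes the parameter only. *)
Lemma mobius_Phi0 t z : -1 < t <= 0 -> 0 <= z <= 1 ->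
  mobius t (Phi (A0 u) z) = left_mass t * mobius (left_param t) z.
Proof.
move=> tP zP; have a0 := loop_weight_ge0 u; have ah := loop_weight_lt u; have x0 := x_gt0 u.
have d1 := den0_gt0 u zP; have d2 := right_param_den tP.
have d3 : 0 < 1 + (x * t - a) * z.
  have -> : 1 + (x * t - a) * z = 1 - z + z * (x * t + 1 - a) by ring.
  have E0 : 0 < x * t + 1 - a by lra.
  case/andP: zP => z0 z1; have := mulr_ge0 z0 (ltW E0).
  move: z1; rewrite le_eqVlt => /orP[/eqP ->|]; lra.
rewrite Phi0E /left_mass /mobius /left_param /half_value; field.
by repeat (apply/andP; split); rewrite gt_eqF //; lra.
Qed.

(** Unlike for the left half, the identity relies on x = 1 - 2 a. *)
Lemma mobius_Phi1 t z : -1 < t <= 0 -> 0 <= z <= 1 ->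
  mobius t (Phi (A1 u) z) = left_mass t + (1 - left_mass t) * mobius (right_param t) z.
Proof.
move=> tP zP; have a0 := loop_weight_ge0 u; have ah := loop_weight_lt u; have x0 := x_gt0 u.
have d1 := den1_gt0 u zP; have d2 := right_param_den tP.
have d3 : 0 < x * t + 1 - a - a * z.
  case/andP: zP => z0 z1; have : 0 <= a * (1 - z) by rewrite mulr_ge0 ?subr_ge0.
  lra.
rewrite Phi1E /left_mass /mobius /right_param /half_value.
move: x0 d1 d2 d3; rewrite !x_loop_weight => x0 d1 d2 d3.
field.
by repeat (apply/andP; split); rewrite gt_eqF //; lra.
Qed.

Lemma left_mass_itv t : -1 < t <= 0 -> 0 <= left_mass t <= 1.
Proof.
move=> tP; have /andP[b0 b1] := half_value_itv.
have d : 0 < 1 + t * half_value by apply: mobius_den_gt0; rewrite // b1 ltW.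
case/andP: tP => t1 t0; rewrite /left_mass /mobius ler_pdivrMr // mul1r.
have n0 : 0 <= (1 + t) * half_value by rewrite mulr_ge0 ?(ltW b0) //; lra.
by rewrite divr_ge0 ?(ltW d) //=; lra.
Qed.

Lemma left_param_itv t : -1 < t <= 0 -> -1 < left_param t <= 0.
Proof.
move=> /andP[t1 t0]; have a0 := loop_weight_ge0 u; have ah := loop_weight_lt u.
have x0 := x_gt0 u; have xE := x_loop_weight u; rewrite /left_param.
have : 0 < x * (1 + t) by rewrite mulr_gt0 //; lra.
have : 0 <= x * (- t) by rewrite mulr_ge0 ?(ltW x0) //; lra.
move=> h1 h2; apply/andP; split; lra.
Qed.

Lemma right_param_itv t : -1 < t <= 0 -> -1 < right_param t <= 0.
Proof.
move=> tP; have a0 := loop_weight_ge0 u; have d := right_param_den tP.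
have d0 : 0 < x * t + 1 - a by lra.
rewrite /right_param mulNr ltrN2 oppr_le0 ltr_pdivrMr // mul1r d /=.
by rewrite divr_ge0 // ltW.
Qed.

(** The Hellinger affinity, along the dyadic partition of level [n], between the
    Lebesgue measure and the measure with distribution function
    [mobius t \o limit_cdf u]. *)
Definition affinity (n : nat) (t : R) : R :=
  \sum_(0 <= j < 2 ^ n)
    Num.sqrt (2 ^- n * (mobius t (f (j.+1%:R / 2 ^+ n)) - mobius t (f (j%:R / 2 ^+ n)))).

Lemma limit_cdf_itv y : 0 <= f y <= 1. Proof. by rewrite limit_cdf_ge0 limit_cdf_le1. Qed.

Lemma affinity0 t : f 0 = 0 -> -1 < t <= 0 -> affinity 0 t = 1.
Proof.
move=> f0 /andP[t1 t0]; rewrite /affinity big_nat1 expr0 invr1 !mulr1 mul1r.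
rewrite f0 limit_cdf_ge1 // /mobius !mulr0 mul0r subr0 !mulr1 divff ?sqrtr1 //.
by rewrite gt_eqF //; lra.
Qed.

(** Self-similarity: the two halves are governed by [left_param t] and
    [right_param t]. *)
Lemma affinityS n t : -1 < t <= 0 ->
  affinity n.+1 t = Num.sqrt 2^-1 * (Num.sqrt (left_mass t) * affinity n (left_param t) +
                               Num.sqrt (1 - left_mass t) * affinity n (right_param t)).
Proof.
move=> tP; have /andP[p0 p1] := left_mass_itv tP.
have q0 : 0 < 2 ^+ n :> R by rewrite exprn_gt0.
have hk (l : R) : 2 * (l / 2 ^+ n.+1) = l / 2 ^+ n.
  by rewrite exprS; field; rewrite gt_eqF.
have lo (j : nat) : (j <= 2 ^ n)%N ->
    mobius t (f (j%:R / 2 ^+ n.+1)) = left_mass t * mobius (left_param t) (f (j%:R / 2 ^+ n)).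
  move=> jn; rewrite limit_cdf_lo ?hk; first by rewrite mobius_Phi0 ?limit_cdf_itv.
  rewrite divr_ge0 ?exprn_ge0 //= ler_pdivrMr ?exprn_gt0 //.
  by rewrite exprS mulKf ?pnatr_eq0 // -natrX ler_nat.
have hi (j : nat) : (j <= 2 ^ n)%N ->
    mobius t (f ((j + 2 ^ n)%N%:R / 2 ^+ n.+1)) =
    left_mass t + (1 - left_mass t) * mobius (right_param t) (f (j%:R / 2 ^+ n)).
  move=> jn; have jn' : j%:R <= 2 ^+ n :> R by rewrite -natrX ler_nat.
  have E : 2 * ((j + 2 ^ n)%N%:R / 2 ^+ n.+1) - 1 = j%:R / 2 ^+ n :> R.
    by rewrite hk natrD natrX mulrDl divff ?gt_eqF // addrK.
  have j0 : 0 <= j%:R / 2 ^+ n :> R by rewrite divr_ge0 // ltW.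
  have j1 : j%:R / 2 ^+ n <= 1 :> R by rewrite ler_pdivrMr // mul1r.
  rewrite limit_cdf_hi; first by rewrite E mobius_Phi1 ?limit_cdf_itv.
  by move: j0 j1; rewrite -E; lra.
have V : 2 ^- n.+1 = 2^-1 * 2 ^- n :> R by rewrite exprS invfM.
rewrite /affinity (@big_cat_nat _ _ _ (2 ^ n)) /=; [|by []|by rewrite leq_exp2l].
have h2 : 0 <= 2^-1 :> R by rewrite invr_ge0.
have hp : 0 <= 2^-1 * left_mass t by rewrite mulr_ge0.
have hq : 0 <= 2^-1 * (1 - left_mass t) by rewrite mulr_ge0 // subr_ge0.
rewrite mulrDr !mulrA -!(sqrtrM _ h2) !mulr_sumr; congr (_ + _).
  rewrite [in LHS]big_nat [in RHS]big_nat; apply: eq_bigr => j /andP[_ jn].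
  rewrite -(sqrtrM _ hp); congr Num.sqrt.
  by rewrite !lo ?(ltnW jn) // V; ring.
rewrite -{1}[(2 ^ n)%N]add0n big_addn expnS mul2n -addnn addnK.
rewrite [in LHS]big_nat [in RHS]big_nat; apply: eq_bigr => j /andP[_ jn].
rewrite -(sqrtrM _ hq); congr Num.sqrt.
by rewrite -addSn !hi ?(ltnW jn) // V; ring.
Qed.

(** The square of the left-hand side is 1/2 + sqrt (p (1 - p)), and
    p (1 - p) = 1/4 - (p - 1/2)^2 <= (1/2 - (p - 1/2)^2)^2. *)
Lemma sqrt_sum_le (p : R) : 0 <= p <= 1 ->
  Num.sqrt 2^-1 * (Num.sqrt p + Num.sqrt (1 - p)) <= 1 - (p - 2^-1) ^+ 2 / 2.
Proof.
move=> /andP[p0 p1]; set e := p - 2^-1.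
have q0 : 0 <= 1 - p by lra.
have pq0 := mulr_ge0 p0 q0.
have e2 : e ^+ 2 <= 4^-1 by rewrite /e; lra.
have pq : Num.sqrt p * Num.sqrt (1 - p) <= 2^-1 - e ^+ 2.
  rewrite -sqrtrM // -[leRHS]ger0_norm; last by lra.
  rewrite -sqrtr_sqr ler_wsqrtr //.
  by have := sqr_ge0 (e ^+ 2); rewrite /e; lra.
have hR : 0 <= 1 - e ^+ 2 / 2 by lra.
have hL : 0 <= Num.sqrt 2^-1 * (Num.sqrt p + Num.sqrt (1 - p)).
  by rewrite mulr_ge0 ?addr_ge0 ?sqrtr_ge0.
rewrite -(@ler_pXn2r _ 2) //.
rewrite exprMn sqr_sqrtr ?invr_ge0 // sqrrD !sqr_sqrtr //.
have := sqr_ge0 (e ^+ 2); move: pq; move: (Num.sqrt p * _) => s; lra.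
Qed.

Section Gap.
Hypotheses (x1 : x != 1) (x2 : x != 2^-1).

(** With p = [left_mass] and b = [half_value], d(t) = (2 p(t) - 1) (1 + t b) is affine
    in t with slope b.  As [left_param] has slope x, d([left_param t]) - x d(t) does not
    depend on t; it equals a (2 x - 1) / (1 - a).  Moreover |d| <= |2 p - 1|. *)
Lemma left_mass_gap : exists2 D : R, 0 < D & forall t, -1 < t <= 0 ->
  D <= `|2 * left_mass t - 1| + `|2 * left_mass (left_param t) - 1|.
Proof.
have a0 := loop_weight_ge0 u; have ah := loop_weight_lt u.
have x0 := x_gt0 u; have xE := x_loop_weight u.
have /andP[b0 b1] := half_value_itv.
have bE : half_value * (1 - a) = x by rewrite /half_value mulfVK // gt_eqF //; lra.
pose d t := (2 * half_value - 1) + half_value * t.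
have dE t : -1 < t <= 0 -> d t = (2 * left_mass t - 1) * (1 + t * half_value).
  move=> tP; have h : 0 < 1 + t * half_value by apply: mobius_den_gt0; rewrite // b1 ltW.
  by rewrite /d /left_mass /mobius; field; rewrite gt_eqF.
have dle t : -1 < t <= 0 -> `|d t| <= `|2 * left_mass t - 1|.
  move=> tP; rewrite dE // normrM ler_piMr //.
  have h : 0 < 1 + t * half_value by apply: mobius_den_gt0; rewrite // b1 ltW.
  by rewrite (ger0_norm (ltW h)) gerDl mulr_le0_ge0 ?(ltW b0) //; case/andP: tP.
pose D := (2 * half_value - 1) * (1 - x) - half_value * a.
exists `|D|.
  have DE : D * (1 - a) = a * (2 * x - 1).
    have -> : D * (1 - a) =
        (2 * (half_value * (1 - a)) - (1 - a)) * (1 - x) - half_value * (1 - a) * a.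
      by rewrite /D; ring.
    by rewrite bE xE; ring.
  have a_neq0 : a != 0 by apply: contra_neq x1 => a_eq0; rewrite xE a_eq0; lra.
  have : D * (1 - a) != 0.
    rewrite DE mulf_neq0 //; apply: contra_neq x2 => h; lra.
  by rewrite normr_gt0; apply: contra_neq => ->; rewrite mul0r.
move=> t tP; have <- : d (left_param t) - x * d t = D by rewrite /d /left_param /D; ring.
rewrite [leRHS]addrC (le_trans (ler_normB _ _)) // lerD ?dle ?left_param_itv //.
rewrite normrM ger0_norm ?(ltW x0) // (le_trans _ (dle t tP)) // ler_piMl //.
lra.
Qed.

(** Two levels at a time: either the first split is unbalanced, or it is balanced
    enough for the left half to carry mass at least 1/4 and the split of the left half
    is unbalanced. *)
Lemma affinity_decay : f 0 = 0 -> exists2 d : R, 0 <= d < 1 &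
  forall n t, -1 < t <= 0 -> affinity n.*2 t <= d ^+ n.
Proof.
move=> f0; have [D D0 gap] := left_mass_gap.
(* The minimum with 1/4 ensures that a split closer than [e] to 1/2 gives the left
   half mass at least 1/4. *)
pose e := Num.min (D / 4) 4^-1.
have e0 : 0 < e by rewrite lt_min divr_gt0 //= invr_gt0.
have e4 : e <= 4^-1 by rewrite ge_min lexx orbT.
have eD : e <= D / 4 by rewrite ge_min lexx.
have ee : e ^+ 2 <= 4^-1 by nra.
have ee0 : 0 < e ^+ 2 by rewrite exprn_gt0.
exists (1 - e ^+ 2 / 16); first by apply/andP; split; lra.
set d := 1 - _; have d0 : 0 <= d by rewrite /d; lra.
pose c : R := Num.sqrt 2^-1.
have c0 : 0 <= c := sqrtr_ge0 _.
have c_ge : 2^-1 <= c.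
  rewrite -[leLHS]ger0_norm ?invr_ge0 // -sqrtr_sqr ler_wsqrtr //; lra.
have one_step m (C : R) s : 0 <= C ->
    (forall t, -1 < t <= 0 -> affinity m t <= C) -> -1 < s <= 0 ->
    affinity m.+1 s <= (1 - (left_mass s - 2^-1) ^+ 2 / 2) * C.
  move=> C0 hC sP; rewrite affinityS // -/c.
  apply: le_trans (ler_wpM2r C0 (sqrt_sum_le (left_mass_itv sP))).
  rewrite -/c -mulrA ler_wpM2l // mulrDl lerD // ler_wpM2l ?sqrtr_ge0 // hC //.
    exact: left_param_itv.
  exact: right_param_itv.
elim=> [|n IH] t tP; first by rewrite affinity0.
rewrite doubleS; set C := d ^+ n in IH *.
have C0 : 0 <= C by rewrite exprn_ge0.
have h0 := one_step _ _ _ C0 IH (left_param_itv tP).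
have h1 := one_step _ _ _ C0 IH (right_param_itv tP).
have /andP[p0 p1] := left_mass_itv tP.
have rle := sqrt_sum_le (left_mass_itv tP); rewrite -/c in rle.
set p := left_mass t in p0 p1 rle.
set e1 := left_mass (left_param t) - 2^-1 in h0.
have sp : p <= Num.sqrt p.
  rewrite -[leLHS]ger0_norm // -sqrtr_sqr ler_wsqrtr //; nra.
have h1' : affinity n.*2.+1 (right_param t) <= C.
  apply: le_trans h1 _; rewrite ler_piMl //.
  by have := sqr_ge0 (left_mass (right_param t) - 2^-1); lra.
rewrite affinityS // -/c -/p.
have e1C : 0 <= e1 ^+ 2 * C by rewrite mulr_ge0 ?sqr_ge0.
have step1 : c * (Num.sqrt p * affinity n.*2.+1 (left_param t) +
    Num.sqrt (1 - p) * affinity n.*2.+1 (right_param t)) <=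
    c * (Num.sqrt p * ((1 - e1 ^+ 2 / 2) * C) + Num.sqrt (1 - p) * C).
  by rewrite ler_wpM2l // lerD // ler_wpM2l ?sqrtr_ge0.
apply: le_trans step1 _.
have -> : c * (Num.sqrt p * ((1 - e1 ^+ 2 / 2) * C) + Num.sqrt (1 - p) * C) =
    (c * (Num.sqrt p + Num.sqrt (1 - p)) - c * Num.sqrt p * e1 ^+ 2 / 2) * C by ring.
rewrite [d ^+ _]exprS -/C ler_wpM2r //.
have cp : p / 2 <= c * Num.sqrt p.
  by rewrite mulrC ler_pM // invr_ge0.
have cpe : p / 2 * e1 ^+ 2 <= c * Num.sqrt p * e1 ^+ 2.
  by rewrite ler_wpM2r // sqr_ge0.
have pe0 : 0 <= p * e1 ^+ 2 by rewrite mulr_ge0 ?sqr_ge0.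
have [big|small] := leP e `|p - 2^-1|.
  have : e ^+ 2 <= (p - 2^-1) ^+ 2.
    by rewrite -[leRHS]real_normK ?num_real // ler_pXn2r ?nnegrE // ltW.
  rewrite /d; lra.
have /ltr_normlP[sm1 sm2] := small.
have big1 : e <= `|e1|.
  have := gap t tP; rewrite -/p.
  have -> : 2 * p - 1 = 2 * (p - 2^-1) by field.
  have -> : 2 * left_mass (left_param t) - 1 = 2 * e1 by rewrite /e1; field.
  rewrite !normrM ger0_norm //; lra.
have : e ^+ 2 <= e1 ^+ 2.
  by rewrite -[leRHS]real_normK ?num_real // ler_pXn2r ?nnegrE // ltW.
have := sqr_ge0 (p - 2^-1).
have : 4^-1 * e1 ^+ 2 <= p * e1 ^+ 2 by rewrite ler_wpM2r ?sqr_ge0 //; lra.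
rewrite /d; lra.
Qed.

End Gap.

End Hellinger.

(** * Singularity *)

Lemma lim_sup_geometric d (T : measurableType d) (R : realType)
    (m : {measure set T -> \bar R}) (F : nat -> set T) (r : R) :
  0 <= r < 1 -> (forall n, measurable (F n)) ->
  (forall n, (m (F n) <= (r ^+ n)%:E)%E) -> m (lim_sup_set F) = 0%E.
Proof.
move=> /andP[r0 r1] mF Fr; apply: lim_sup_set_cvg0 => //.
apply: (@le_lt_trans _ _ ((1 - r)^-1)%:E); last exact: ltry.
apply: lime_le; first exact: is_cvg_nneseries.
apply: nearW => n; apply: (@le_trans _ _ (\sum_(0 <= k < n) (r ^+ k)%:E)%E).
  by apply: lee_sum.
rewrite sumEFin lee_fin -[leRHS]mul1r ler_pdivlMr ?subr_gt0 // big_mkord.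
set S := \sum_(_ < _) _; have -> : S * (1 - r) = - ((r - 1) * S) by ring.
by rewrite -subrX1 opprB gerBl exprn_ge0.
Qed.

Section Singular.
Context {R : realType}.
Variable u : R.
Local Notation x := (x_ u).
Local Notation f := (limit_cdf u).
Local Notation mu := (limit_law u).

Definition cell (n j : nat) : set (measurableTypeR R) :=
  `]j%:R / 2 ^+ n, j.+1%:R / 2 ^+ n]%classic.
Definition cell_mass (n j : nat) : R := f (j.+1%:R / 2 ^+ n) - f (j%:R / 2 ^+ n).
(** The flag [c] tells the intervals of density at least 1 from the other ones. *)
Definition cells (c : bool) (n : nat) : set (measurableTypeR R) :=
  \big[setU/set0]_(j < 2 ^ n) if (2 ^- n <= cell_mass n j) == c then cell n j else set0.

Lemma measurable_cells c n : measurable (cells c n).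
Proof.
by apply: bigsetU_measurable => j _; case: ifP => // _; exact: measurable_itv.
Qed.

(** Used with the smaller of the Lebesgue measure and the limit law on each selected
    interval, which is at most their geometric mean. *)
Lemma cells_le (m : {measure set (measurableTypeR R) -> \bar R}) c n (w : nat -> R) :
  (forall j, m (cell n j) = (w j)%:E) ->
  (forall j, (2 ^- n <= cell_mass n j) == c -> w j <= Num.sqrt (2 ^- n * cell_mass n j)) ->
  (m (cells c n) <= (affinity u n 0)%:E)%E.
Proof.
move=> mw wle; apply: le_trans (Boole_inequality m (A := fun j =>
    if (2 ^- n <= cell_mass n j) == c then cell n j else set0) (n := 2 ^ n) _) _.
  by move=> j _; case: ifP => // _; exact: measurable_itv.
rewrite /affinity big_mkord -sumEFin; apply: lee_sum => j _.
rewrite /mobius !mul0r !addr0 !mul1r !divr1 -/(cell_mass n j).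
case: ifP => [cj|_]; first by rewrite [leLHS](mw j) lee_fin; exact: wle.
by rewrite measure0 lee_fin sqrtr_ge0.
Qed.

Lemma cell_endpoints n j : j%:R / 2 ^+ n <= j.+1%:R / 2 ^+ n :> R.
Proof. by rewrite ler_pM2r ?invr_gt0 ?exprn_gt0 // ler_nat. Qed.

Lemma cell_mass_ge0 n j : 0 <= cell_mass n j.
Proof. by rewrite subr_ge0 limit_cdf_nd // cell_endpoints. Qed.

Lemma lebesgue_cells n : (lebesgue_measure (cells true n) <= (affinity u n 0)%:E)%E.
Proof.
have p0 : 0 < 2 ^- n :> R by rewrite invr_gt0 exprn_gt0.
apply: (@cells_le lebesgue_measure true n (fun=> 2 ^- n)) => [j|j /eqP h].
  rewrite /cell; apply: etrans (lebesgue_measure_itv _) _.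
  rewrite /= lte_fin ltr_pM2r ?invr_gt0 ?exprn_gt0 //.
  rewrite ltr_nat ltnSn -EFinB; congr EFin.
  by rewrite -mulrBl -natr1 addrAC subrr add0r mul1r.
rewrite -[leLHS](ger0_norm (ltW p0)) -sqrtr_sqr ler_wsqrtr //.
by rewrite expr2 ler_pM2l.
Qed.

Lemma limit_law_cells n : (mu (cells false n) <= (affinity u n 0)%:E)%E.
Proof.
have p0 : 0 < 2 ^- n :> R by rewrite invr_gt0 exprn_gt0.
apply: (@cells_le mu _ _ (cell_mass n)) => [j|j /eqP h].
  by rewrite /cell; apply: (limit_law_oc u); exact: cell_endpoints.
rewrite -[leLHS](ger0_norm (cell_mass_ge0 n j)) -sqrtr_sqr ler_wsqrtr //.
by rewrite expr2 ler_wpM2r ?cell_mass_ge0 // ltW // ltNge h.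
Qed.

Lemma cells_cover n y : 0 < y <= 1 -> cells true n y \/ cells false n y.
Proof.
move=> /andP[y0 y1]; have p0 : 0 < 2 ^+ n :> R by rewrite exprn_gt0.
have c0 : (0 < Num.ceil (2 ^+ n * y)) by rewrite ceil_gt0 mulr_gt0.
have c1 : Num.ceil (2 ^+ n * y) <= (2 ^ n)%N%:Z.
  by rewrite ceil_le_int -[leRHS]/((2 ^ n)%N%:R) natrX ger_pMr.
have /andP[c2 c3] := ceil_itv (2 ^+ n * y).
have [j jE] : exists j : nat, Num.ceil (2 ^+ n * y) = j.+1.
  exists (absz (Num.ceil (2 ^+ n * y))).-1.
  by move: (Num.ceil _) c0 => c; lia.
rewrite jE in c1 c2 c3.
have jn : (j < 2 ^ n)%N by lia.
have yj : cell n j y.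
  rewrite /cell /= in_itv /= ltr_pdivrMr // ler_pdivlMr // ![y * _]mulrC.
  by rewrite c3 andbT; move: c2; rewrite intS [1 + _]addrC addrK.
have inb c : (2 ^- n <= cell_mass n j) == c -> cells c n y.
  move=> cj; rewrite /cells -(bigcup_mkord _ (fun j =>
    if (2 ^- n <= cell_mass n j) == c then cell n j else set0)).
  by exists j => //; rewrite cj.
by case E: (2 ^- n <= cell_mass n j); [left|right]; apply: inb; rewrite E.
Qed.

Lemma limit_law_singular : f 0 = 0 -> x != 1 -> x != 2^-1 ->
  mutually_singular mu lebesgue01.
Proof.
move=> f0 x1 x2; have [d d01 hd] := affinity_decay x1 x2 f0.
have z1 : -1 < (0 : R) <= 0 by rewrite lexx andbT ltrN10.
have mC c n : measurable (cells c n.*2) := @measurable_cells c n.*2.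
have B0 : mu (lim_sup_set (fun n => cells false n.*2)) = 0%E.
  apply: (lim_sup_geometric (r := d)) => // n.
  by apply: le_trans (limit_law_cells _) _; rewrite lee_fin hd.
have G0 : lebesgue_measure (lim_sup_set (fun n => cells true n.*2)) = 0%E.
  apply: (lim_sup_geometric (r := d)) => // n.
  by apply: le_trans (lebesgue_cells _) _; rewrite lee_fin hd.
have mlim c : measurable (lim_sup_set (fun n => cells c n.*2)).
  apply: bigcap_measurable; first by exists 0%N.
  by move=> n _; apply: bigcup_measurable => k _.
have O0 : mu (~` `]0%R, 1%R]%classic) = 0%E.
  rewrite probability_setC ?limit_law_oc // f0 limit_cdf_ge1 // subr0.
  by rewrite -EFinB subrr.
have mO : measurable (~` `]0%R, 1%R]%classic : set (measurableTypeR R)).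
  by apply: measurableC; exact: measurable_itv.
exists (lim_sup_set (fun n => cells false n.*2) `|` ~` `]0%R, 1%R]%classic); split.
- exact: measurableU.
- apply/eqP; rewrite eq_le measure_ge0 andbT.
  apply: le_trans (measureU2 mu (mlim false) mO) _.
  by rewrite [X in (X + _)%E]B0 [X in (_ + X)%E]O0 adde0.
- apply/eqP; rewrite eq_le measure_ge0 andbT -G0 /lebesgue01 /mrestr.
  apply: le_measure; rewrite ?inE //.
    apply: measurableI; last exact: measurable_itv.
    by apply: measurableC; exact: measurableU.
  move=> y [+ _]; rewrite setCU setCK => -[/= nB]; rewrite in_itv /= => y01 n _.
  have [k nk nBk] : exists2 k, (n <= k)%N & ~ cells false k.*2 y.
    apply: contrapT => h; apply: nB => m _; apply: contrapT => h'.
    apply: h; exists (maxn m n); first exact: leq_maxr.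
    by move=> c; apply: h'; exists (maxn m n) => //; exact: leq_maxl.
  by exists k => //; case: (cells_cover k.*2 y01).
Qed.

End Singular.

Section DegenerateCase.
Context {R : realType}.

Lemma limit_cdf00 : limit_cdf (0 : R) 0 = 1.
Proof.
have a0 : loop_weight (0 : R) = 0 by rewrite /loop_weight expr0n mul0r.
have h n : finite_cdf (0 : R) n 0 = 1.
  elim: n => [|n IH] /=; first by rewrite lexx.
  rewrite ltxx invr_gt0 ltr0n mulr0 IH Phi0E x_loop_weight a0.
  by rewrite !mulr0 !mul0r subr0 mulr1 divr1.
have c1 := @finite_cdf_cvg R 0 0.
have c2 : finite_cdf (0 : R) n 0 @[n --> \oo] --> (1 : R).
  by under eq_fun do rewrite h; exact: cvg_cst.
exact: (cvg_unique _ c1 c2).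
Qed.

Lemma limit_law_singular0 : mutually_singular (limit_law (0 : R)) lebesgue01.
Proof.
set mu := limit_law _.
have m1 : measurable (`]-oo, 0%R[%classic : set (measurableTypeR R)) by exact: measurable_itv.
have m2 : measurable (~` `]-oo, 0%R]%classic : set (measurableTypeR R)).
  by apply: measurableC; exact: measurable_itv.
have mu2 : mu (~` `]-oo, 0%R]%classic) = 0%E.
  rewrite probability_setC; last exact: measurable_itv.
  by rewrite limit_law_cdf limit_cdf00 subee.
exists (`]-oo, 0%R[%classic `|` ~` `]-oo, 0%R]%classic); split.
- exact: measurableU.
- apply/eqP; rewrite eq_le measure_ge0 andbT.
  apply: le_trans (measureU2 mu m1 m2) _.
  by rewrite [X in (X + _)%E]limit_law_neg [X in (_ + X)%E]mu2 adde0.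
- apply/eqP; rewrite eq_le measure_ge0 andbT -(lebesgue_measure_set1 (0 : R)).
  rewrite /lebesgue01 /mrestr; apply: le_measure; rewrite ?inE.
  + apply: measurableI; last exact: measurable_itv.
    by apply: measurableC; exact: measurableU.
  + exact: measurable_set1.
  + move=> y [+ _]; rewrite setCU setCK => -[/= h1]; move: h1; rewrite !in_itv /=.
    by move=> /negP; rewrite -leNgt => h1 h2; apply/eqP; rewrite eq_le h1 h2.
Qed.

End DegenerateCase.

(** * Absolute continuity for the simple random walk *)

Section SimpleRandomWalk.
Context {R : realType}.
Local Notation f := (limit_cdf (1 : R)).
Local Notation mu := (limit_law (1 : R)).

Lemma x_1E : x_ (1 : R) = 2^-1.
Proof.
have s9 : Num.sqrt (9 : R) = 3.
  have -> : (9 : R) = 3 ^+ 2 by rewrite -natrX.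
  by rewrite sqrtr_sqr ger0_norm.
rewrite /x_ expr1n mulr1 (_ : 1 + 8 = 9 :> R); last by ring.
by rewrite s9; field.
Qed.

Lemma loop_weight1 : loop_weight (1 : R) = 4^-1.
Proof. by rewrite /loop_weight x_1E; field. Qed.

(** The conditional law of the minimum of the simple random walk given its exit at 1,
    by the gambler's ruin formula. *)
Definition srw_cdf (y : R) : R := 2 * y / (1 + y).

(** [srw_cdf] solves the functional equation, whose branches are contractions of ratios
    8/9 and 1/2 for [u = 1]. *)
Lemma finite_cdf_srw n y : 0 <= y <= 1 ->
  `|finite_cdf 1 n y - srw_cdf y| <= (8 / 9) ^+ n.
Proof.
elim: n y => [|n IH] y /andP[y0 y1].
  rewrite expr0 /= y0 /srw_cdf.
  have -> : 1 - 2 * y / (1 + y) = (1 - y) / (1 + y).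
    by field; rewrite gt_eqF //; lra.
  by rewrite ger0_norm ?ler_pdivrMr ?divr_ge0 //; lra.
have contract (z w k : R) : 0 <= k -> k <= 8 / 9 ->
    `|z - w| <= (8 / 9) ^+ n -> `|k * (z - w)| <= (8 / 9) ^+ n.+1.
  by move=> k0 k1 zw; rewrite exprS normrM ger0_norm // ler_pM.
have srw01 v : 0 <= v <= 1 -> 0 <= srw_cdf v <= 1.
  by move=> v01; rewrite /srw_cdf divr_ge0 ?ler_pdivrMr //=; lra.
rewrite /= ltNge y0 /=.
have [yh|yh] := ltP y 2^-1.
  have iy : 0 <= 2 * y <= 1 by lra.
  have := IH _ iy; set z := finite_cdf _ _ _ => zP.
  have /andP[z0 z1] : 0 <= z <= 1 by exact: finite_cdf_itv.
  have /andP[w0 w1] := srw01 _ iy.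
  have -> : srw_cdf y = Phi (A0 1) (srw_cdf (2 * y)).
    rewrite Phi0E x_1E loop_weight1 /srw_cdf; field.
    by repeat (apply/andP; split); rewrite gt_eqF //; lra.
  rewrite !Phi0E x_1E loop_weight1; set w := srw_cdf (2 * y) in zP w0 w1 *.
  have dz : 3 / 4 <= 1 - 4^-1 * z by lra.
  have dw : 3 / 4 <= 1 - 4^-1 * w by lra.
  have -> : 2^-1 * z / (1 - 4^-1 * z) - 2^-1 * w / (1 - 4^-1 * w) =
      (2^-1 / ((1 - 4^-1 * z) * (1 - 4^-1 * w))) * (z - w).
    by field; repeat (apply/andP; split); rewrite gt_eqF //; lra.
  have d : 9 / 16 <= (1 - 4^-1 * z) * (1 - 4^-1 * w).
    by rewrite (_ : 9 / 16 = 3 / 4 * (3 / 4)) ?ler_pM //; field.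
  by apply: contract zP; rewrite ?divr_ge0 ?ler_pdivrMr //; lra.
have [{}y1|y1'] := ltP y 1; last first.
  have -> : y = 1 by lra.
  by rewrite /srw_cdf mulr1 divff // subrr normr0 exprn_ge0.
have iy : 0 <= 2 * y - 1 <= 1 by lra.
have := IH _ iy; set z := finite_cdf _ _ _ => zP.
have /andP[z0 z1] : 0 <= z <= 1 by exact: finite_cdf_itv.
have /andP[w0 w1] := srw01 _ iy.
have -> : srw_cdf y = Phi (A1 1) (srw_cdf (2 * y - 1)).
  rewrite Phi1E x_1E loop_weight1 /srw_cdf; field.
  by repeat (apply/andP; split); rewrite gt_eqF //; lra.
rewrite !Phi1E x_1E loop_weight1; set w := srw_cdf (2 * y - 1) in zP w0 w1 *.
have dz : 2^-1 <= 1 - 4^-1 - 4^-1 * z by lra.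
have dw : 2^-1 <= 1 - 4^-1 - 4^-1 * w by lra.
have -> : 2^-1 / (1 - 4^-1 - 4^-1 * z) - 2^-1 / (1 - 4^-1 - 4^-1 * w) =
    (8^-1 / ((1 - 4^-1 - 4^-1 * z) * (1 - 4^-1 - 4^-1 * w))) * (z - w).
  by field; repeat (apply/andP; split); rewrite gt_eqF //; lra.
have d : 4^-1 <= (1 - 4^-1 - 4^-1 * z) * (1 - 4^-1 - 4^-1 * w).
  by rewrite [leLHS](_ : _ = 2^-1 * 2^-1) ?ler_pM //; field.
by apply: contract zP; rewrite ?divr_ge0 ?ler_pdivrMr //; lra.
Qed.

Lemma limit_cdf_srw y : 0 <= y <= 1 -> f y = srw_cdf y.
Proof.
move=> y01; have c : finite_cdf (1 : R) n y @[n --> \oo] --> srw_cdf y.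
  apply/cvgrPdist_le => e e0.
  have /cvgrPdist_le/(_ _ e0) : (8 / 9 : R) ^+ n @[n --> \oo] --> 0.
    by apply: cvg_expr; rewrite ger0_norm //; lra.
  apply: filterS => n; rewrite sub0r normrN => ne.
  by rewrite distrC (le_trans (finite_cdf_srw n y01)) // (le_trans _ ne) // ler_norm.
exact: (cvg_unique _ (@finite_cdf_cvg R 1 y) c).
Qed.

Lemma limit_cdf_lipschitz y z : y <= z -> f z - f y <= 2 * (z - y).
Proof.
have f0 : f 0 = 0 by rewrite limit_cdf_srw ?lexx //= /srw_cdf mulr0 mul0r.
move=> yz; wlog y0 : y yz / 0 <= y.
  move=> H; have [y0|y0] := leP 0 y; first exact: H.
  have [z0|z0] := ltP z 0; first by rewrite (limit_cdf_lt0 _ y0) (limit_cdf_lt0 _ z0); lra.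
  have := H 0 z0 (lexx 0); rewrite (limit_cdf_lt0 _ y0) f0; lra.
wlog z1 : z yz / z <= 1.
  move=> H; have [z1|z1] := leP z 1; first exact: H.
  have [y1|y1] := leP 1 y.
    by rewrite (limit_cdf_ge1 _ y1) (limit_cdf_ge1 _ (ltW z1)); lra.
  have := H 1 (ltW y1) (lexx 1); rewrite (limit_cdf_ge1 _ (lexx 1)) (limit_cdf_ge1 _ (ltW z1)).
  lra.
rewrite !limit_cdf_srw /srw_cdf; [|lra..].
have -> : 2 * z / (1 + z) - 2 * y / (1 + y) = 2 * (z - y) / ((1 + z) * (1 + y)).
  by field; apply/andP; split; rewrite gt_eqF //; lra.
have d : 1 <= (1 + z) * (1 + y).
  by rewrite -[leLHS]mulr1 ler_pM //; lra.
by rewrite ler_pdivrMr ?ler_peMr //; lra.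
Qed.

(** Nondecreasing because [limit_cdf 1] is 2-Lipschitz, so that the Stieltjes measures
    of [limit_cdf 1] and [slack] add up to twice the Lebesgue measure. *)
Definition slack (y : R) : R := 2 * y - f y.

Lemma slack_nd : nondecreasing slack.
Proof. by move=> y z yz; have := limit_cdf_lipschitz yz; rewrite /slack; lra. Qed.

Lemma slack_rc : right_continuous slack.
Proof.
move=> y; apply: cvgB; last exact: limit_cdf_rc.
by apply: cvgMr; apply: cvg_at_right_filter; exact: cvg_id.
Qed.

HB.instance Definition _ := isCumulative.Build R _ R slack slack_nd slack_rc.

Lemma limit_law_le (A : set (measurableTypeR R)) : measurable A ->
  (mu A <= lebesgue_measure A + lebesgue_measure A)%E.
Proof.
move=> mA; pose m : {measure set (measurableTypeR R) -> \bar R} :=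
  measure_add mu (lebesgue_stieltjes_measure slack).
pose l2 : {measure set (measurableTypeR R) -> \bar R} :=
  measure_add (@lebesgue_measure R) (@lebesgue_measure R).
have l2E a b : a <= b -> l2 `]a, b]%classic = (b - a + (b - a))%:E.
  move=> ab; have lE : lebesgue_measure (`]a, b]%classic : set R) = (b - a)%:E.
    rewrite lebesgue_measure_itv /= lte_fin -EFinB; case: ltP => // ba.
    by rewrite (_ : b - a = 0) //; lra.
  apply: etrans (measure_addE _ _ _) _.
  by rewrite [X in (X + X)%E]lE EFinD.
suff E : l2 A = m A.
  have l2A : l2 A = (lebesgue_measure A + lebesgue_measure A)%E.
    exact: measure_addE.
  rewrite -l2A E; apply: le_trans (_ : _ <= mu A + _)%E _.
    by apply: leeDl; exact: (measure_ge0 (lebesgue_stieltjes_measure slack) A).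
  by rewrite le_eqVlt; apply/orP; left; apply/eqP/esym; exact: measure_addE.
have C : \bigcup_n `](- n%:R : R), n%:R]%classic = [set: measurableTypeR R].
  exact: (bigcup_itvT false false).
have U := @measure_unique _ R (measurableTypeR R) (@ocitv R)
  (fun n => `](- n%:R : R), n%:R]%classic) erefl (@ocitvI R)
  (fun n => is_ocitv _ _) C l2 m.
apply: U => //.
- move=> _ [[a b] _ <-] /=.
  have [ab|ba] := leP a b; last first.
    by rewrite set_itv_ge ?measure0 // bnd_simp -leNgt ltW.
  rewrite [LHS](l2E _ _ ab); apply: etrans (esym (measure_addE _ _ _)).
  rewrite [X in (X + _)%E](limit_law_oc 1 ab).
  rewrite [X in (_ + X)%E](lebesgue_stieltjes_oc _ ab) -EFinD; congr EFin.
  by rewrite /= /slack; ring.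
- by move=> k; rewrite [ltLHS]l2E ?ltry // ge0_cp.
Qed.

Lemma limit_law_dominated : mu `<< lebesgue01.
Proof.
apply/null_content_dominatesP => A mA A0.
have m01 : measurable (`[0%R, 1%R]%classic : set (measurableTypeR R)).
  exact: measurable_itv.
have mAI : measurable (A `&` `[0%R, 1%R]) by exact: measurableI.
have mAD : measurable (A `\` `[0%R, 1%R]) by exact: measurableD.
have I0 : mu (A `&` `[0%R, 1%R]%classic) = 0%E.
  apply/eqP; rewrite eq_le measure_ge0 andbT.
  apply: le_trans (limit_law_le mAI) _.
  have A1 : lebesgue_measure (A `&` `[0%R, 1%R]%classic) = 0%E := A0.
  by rewrite [X in (X + X)%E]A1 adde0.
have D0 : mu (A `\` `[0%R, 1%R]%classic) = 0%E.
  apply/eqP; rewrite eq_le measure_ge0 andbT.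
  apply: (@le_trans _ _ (mu (~` `[0%R, 1%R]%classic))).
    have mC := measurableC m01.
    by apply: le_measure; rewrite ?inE // => y [].
  by rewrite probability_setC // [X in (_ - X)%E](limit_law_itv01 1) subee.
rewrite -(setUIDK A `[0%R, 1%R]%classic).
apply/eqP; rewrite eq_le measure_ge0 andbT.
apply: le_trans (measureU2 mu mAI mAD) _.
by rewrite [X in (X + _)%E]I0 [X in (_ + X)%E]D0 adde0.
Qed.

End SimpleRandomWalk.

(** * The limit law for all values of the parameter *)

Lemma x_eq1 (R : realType) (u : R) : x_ u = 1 -> u = 0.
Proof.
move=> x1; have := x_loop_weight u; rewrite /loop_weight x1 expr1n mulr1 => h.
have u2 : u ^+ 2 = 0 by lra.
by apply/eqP; rewrite -sqrf_eq0 u2.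
Qed.

Lemma x_eq_half (R : realType) (u : R) : 0 <= u -> x_ u = 2^-1 -> u = 1.
Proof.
move=> u0 x1; have := x_loop_weight u; rewrite /loop_weight x1 => h.
have u2 : u ^+ 2 = 1 by lra.
by apply/eqP; rewrite -(@eqrXn2 _ 2) // expr1n u2.
Qed.

Lemma limit_cdf0_gt0 (R : realType) (u : R) : 0 < u -> limit_cdf u 0 = 0.
Proof.
move=> u0; case: (limit_cdf0 u) => // /eqP.
by rewrite /loop_weight mulf_eq0 !sqrf_eq0 (gt_eqF u0) (gt_eqF (x_gt0 u)).
Qed.

Theorem theorem1p2 (R : realType) (u : R) (u_ge0 : 0 <= u)
    (P : probability Winfty R) (hP : is_Pu u P) :
  exists mu : probability (measurableTypeR R) R,
    let f := distribution_function mu in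
    [/\ mu `[0%R, 1%R]%classic = 1%E,
        weak_cvg (fun n => scaled_range n : {RV P >-> R}) mu,
        0 < u ->
          (forall x, 0 <= x <= 2^-1 -> f x = Phi (A0 u) (f (2 * x))) /\
          (forall x, 2^-1 <= x <= 1 -> f x = Phi (A1 u) (f (2 * x - 1))),
        u = 1 -> mu `<< lebesgue01
      & u != 1 -> mutually_singular mu lebesgue01].
Proof.
exists (limit_law u); split.
- exact: limit_law_itv01.
- exact (limit_law_weak_cvg u_ge0 hP).
- by move=> _; split=> y yP; rewrite !distribution_function_limit_law;
    [exact: limit_cdf_lo|exact: limit_cdf_hi].
- by move=> ->; exact: limit_law_dominated.
- move=> u1; have [->|u_neq0] := eqVneq u 0; first exact: limit_law_singular0.
  apply: limit_law_singular.
  + by apply: limit_cdf0_gt0; rewrite lt_def u_neq0.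
  + by apply: contra_neq u_neq0; exact: x_eq1.
  + by apply: contra_neq u1; exact: x_eq_half.
Qed.
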